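(* Let $T$ be a preprocessed text and $P$ a pattern with $|P| < |T|$, and let $P'$ be obtained from $P$ by editing its $i$-th character (inserting a character at position $i$ or deleting the character at position $i$). Suppose an occurrence partition of $P$ with respect to $T$ is given, stored as a balanced binary search tree whose nodes are the pieces in order, each with its length and its suffix range with respect to $T$. Then an occurrence partition of $P'$ with respect to $T$ (in the same representation) can be found in $\mathcal{O}(\log |T|)$ time.
   Context: Strings are indexed from $0$; $\circ$ is concatenation; $T_p$ is the suffix of $T$ starting at $p$. The suffix array $\mathcal{SA}$ of $T$ has $\mathcal{SA}[i]$ equal to the starting index of the $i$-th smallest suffix of $T$ in lexicographic order (from $i=0$); $\mathcal{ISA}$ is its inverse; $\mathcal{LCP}[i] = lcp(T_{\mathcal{SA}[i]}, T_{\mathcal{SA}[i+1]})$. Preprocessing of $T$ consists of computing $\mathcal{SA}$, $\mathcal{ISA}$, $\mathcal{LCP}$ and a constant-time range-minimum-query structure on $\mathcal{LCP}$, in $\mathcal{O}(|T|)$ time (alphabet of integers bounded by $|T|^c$, $c$ constant). For a string $Q$, with $S$ the set of indices at which $Q$ occurs in $T$, the suffix range is $\mathcal{SR}(Q,T) = \{ i : \mathcal{SA}[i] \in S\}$, a half-open range $[\ell,r)$ (the empty range $[0,0)$ if $Q$ does not occur). An occurrence partition of $P$ with respect to $T$ is a sequence of nonempty strings $(P_1, \dots, P_k)$ with $P = P_1 \circ \dots \circ P_k$ such that: (1) each $P_i$ either occurs as a substring of $T$, or $|P_i| = 1$ and $P_i$ is a character not occurring in $T$; (2) for each $1 \le i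 < k$, $P_i \circ P_{i+1}$ does not occur in $T$. *)

(* Defs.v *)
From mathcomp Require Import all_boot all_order.

Set Implicit Arguments.
Unset Strict Implicit.
Unset Printing Implicit Defensive.

Notation str := (seq nat).

Definition suffix_le (T : str) : rel nat :=
  fun p q => (drop p T <= drop q T :> seqlexi nat)%O.

Definition SA (T : str) : seq nat := sort (suffix_le T) (iota 0 (size T)).

Definition ISA (T : str) : seq nat :=
  [seq index p (SA T) | p <- iota 0 (size T)].

Fixpoint lcp (s t : str) : nat :=
  match s, t with
  | a :: s', b :: t' => if a == b then (lcp s' t').+1 else 0
  | _, _ => 0
  end.

Definition LCP (T : str) : seq nat :=
  [seq lcp (drop (nth 0 (SA T) i) T) (drop (nth 0 (SA T) i.+1) T)
  | i <- iota 0 (size T).-1].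

(* [q i j] is the position of a minimum of [A] on [i, j); nothing is assumed
   about which minimum is returned or about malformed queries. *)
Definition is_rmq (A : seq nat) (q : nat -> nat -> nat) : Prop :=
  forall i j, i < j <= size A ->
    i <= q i j < j /\ (forall k, i <= k < j -> nth 0 A (q i j) <= nth 0 A k).

Definition over_alphabet (c : nat) (T s : str) : bool :=
  all (fun a => a <= size T ^ c) s.

Definition occurs_at (Q T : str) (p : nat) : bool := prefix Q (drop p T).

Definition SR_set (Q T : str) : seq nat :=
  [seq i <- iota 0 (size T) | occurs_at Q T (nth 0 (SA T) i)].

(* The pair (l, r) stands for [l, r).  The increasing sequence [SR_set Q T]
   consists of consecutive integers, so its first and last elements
   determine it. *)
Definition SR (Q T : str) : nat * nat :=
  if SR_set Q T is i :: s then (i, (last i s).+1) else (0, 0).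

Definition occurrence_partition (P T : str) (ps : seq str) : Prop :=
  [/\ flatten ps = P,
      forall Q, Q \in ps -> Q <> [::],
      forall Q, Q \in ps ->
        infix Q T \/ (exists2 a, Q = [:: a] & a \notin T)
    & forall j, j.+1 < size ps ->
        ~~ infix (nth [::] ps j ++ nth [::] ps j.+1) T].

Inductive edit := Insert (a : nat) | Delete.

Definition edit_ok (P : str) (i : nat) (e : edit) : bool :=
  match e with
  | Insert _ => i <= size P
  | Delete => i < size P
  end.

Definition apply_edit (P : str) (i : nat) (e : edit) : str :=
  match e with
  | Insert a => take i P ++ a :: drop i P
  | Delete => take i P ++ drop i.+1 P
  end.

(* (length, suffix range) *)

Definition piece : Type := nat * (nat * nat).

Inductive tree := Leaf | Node (l : tree) (x : piece) (r : tree).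

Fixpoint inorder (t : tree) : seq piece :=
  if t is Node l x r then inorder l ++ x :: inorder r else [::].

Fixpoint height (t : tree) : nat :=
  if t is Node l _ r then (maxn (height l) (height r)).+1 else 0.

Definition total_length (t : tree) : nat := sumn [seq x.1 | x <- inorder t].

(* The AVL condition. *)
Fixpoint balanced (t : tree) : bool :=
  if t is Node l _ r then
    [&& height l <= (height r).+1, height r <= (height l).+1,
        balanced l & balanced r]
  else true.

(* The machine: a random access machine, programmed by first-order recursive
   procedures.  All values are natural numbers; the addresses 1, ..., [brk]
   of the memory are allocated, and 0 serves as the null address.  A freshly
   allocated cell has arbitrary contents. *)

Record heap := Heap { mem : nat -> nat; brk : nat }.

Definition update (h : heap) (p v : nat) : heap :=
  Heap (fun q => if q == p then v else mem h q) (brk h).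

Inductive binop := Add | Sub | Lt | Eq.

Definition do_binop (o : binop) (m n : nat) : nat :=
  match o with
  | Add => m + n
  | Sub => m - n
  | Lt => m < n
  | Eq => m == n
  end.

(* [Let x e1 e2] binds register [x] of the current procedure frame in [e2].
   [Call f es] runs the body of procedure [f] in a new frame whose registers
   0, 1, ... hold the values of [es].  The last six constructors read the
   preprocessed text.
   There is no multiplication: in time t values grow by a factor of at most
   2 ^ O(t), so unit cost is legitimate, as words stay at O(log |T|) bits
   in time O(log |T|). *)
Inductive expr :=
| Var (x : nat)
| Const (n : nat)
| Bin (o : binop) (e1 e2 : expr)
| Half (e : expr)
| Let (x : nat) (e1 e2 : expr)
| If (e e1 e2 : expr)
| Call (f : nat) (es : seq expr)
| Read (e : expr)
| Write (e1 e2 : expr)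
| Alloc (k : nat)
| TextSize
| TextChar (e : expr)
| TextSA (e : expr)
| TextISA (e : expr)
| TextLCP (e : expr)
| TextRMQ (e1 e2 : expr).

Definition program := seq expr.

Section Semantics.

Variables (T : str) (rmq : nat -> nat -> nat) (prog : program).

(* [eval env h e h' v n]: in frame [env] and heap [h], [e] evaluates to [v]
   in time [n], leaving heap [h']. *)
Inductive eval : seq nat -> heap -> expr -> heap -> nat -> nat -> Prop :=
| eval_Var env h x : eval env h (Var x) h (nth 0 env x) 1
| eval_Const env h k : eval env h (Const k) h k 1
| eval_Bin env h o e1 e2 h1 v1 n1 h2 v2 n2 :
    eval env h e1 h1 v1 n1 -> eval env h1 e2 h2 v2 n2 ->
    eval env h (Bin o e1 e2) h2 (do_binop o v1 v2) (n1 + n2).+1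
| eval_Half env h e h1 v n :
    eval env h e h1 v n -> eval env h (Half e) h1 v./2 n.+1
| eval_Let env h x e1 e2 h1 v1 n1 h2 v2 n2 :
    eval env h e1 h1 v1 n1 -> eval (set_nth 0 env x v1) h1 e2 h2 v2 n2 ->
    eval env h (Let x e1 e2) h2 v2 (n1 + n2).+1
| eval_If env h e e1 e2 h1 v n1 h2 w n2 :
    eval env h e h1 v n1 -> eval env h1 (if v != 0 then e1 else e2) h2 w n2 ->
    eval env h (If e e1 e2) h2 w (n1 + n2).+1
| eval_Call env h f es h1 vs n1 h2 v n2 :
    evals env h es h1 vs n1 -> eval vs h1 (nth (Const 0) prog f) h2 v n2 ->
    eval env h (Call f es) h2 v (n1 + n2).+1
| eval_Read env h e h1 p n :
    eval env h e h1 p n -> eval env h (Read e) h1 (mem h1 p) n.+1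
| eval_Write env h e1 e2 h1 p n1 h2 v n2 :
    eval env h e1 h1 p n1 -> eval env h1 e2 h2 v n2 ->
    eval env h (Write e1 e2) (update h2 p v) 0 (n1 + n2).+1
| eval_Alloc env h k :
    eval env h (Alloc k) (Heap (mem h) (brk h + k)) (brk h).+1 k.+1
| eval_TextSize env h : eval env h TextSize h (size T) 1
| eval_TextChar env h e h1 i n :
    eval env h e h1 i n -> eval env h (TextChar e) h1 (nth 0 T i) n.+1
| eval_TextSA env h e h1 i n :
    eval env h e h1 i n -> eval env h (TextSA e) h1 (nth 0 (SA T) i) n.+1
| eval_TextISA env h e h1 i n :
    eval env h e h1 i n -> eval env h (TextISA e) h1 (nth 0 (ISA T) i) n.+1
| eval_TextLCP env h e h1 i n :
    eval env h e h1 i n -> eval env h (TextLCP e) h1 (nth 0 (LCP T) i) n.+1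
| eval_TextRMQ env h e1 e2 h1 i n1 h2 j n2 :
    eval env h e1 h1 i n1 -> eval env h1 e2 h2 j n2 ->
    eval env h (TextRMQ e1 e2) h2 (rmq i j) (n1 + n2).+1
with evals : seq nat -> heap -> seq expr -> heap -> seq nat -> nat -> Prop :=
| evals_nil env h : evals env h [::] h [::] 0
| evals_cons env h e es h1 v n1 h2 vs n2 :
    eval env h e h1 v n1 -> evals env h1 es h2 vs n2 ->
    evals env h (e :: es) h2 (v :: vs) (n1 + n2).

Definition runs (args : seq nat) (h h' : heap) (v n : nat) : Prop :=
  eval args h (nth (Const 0) prog 0) h' v n.

End Semantics.

(* [tree_at h p t]: the tree [t] is stored in [h] at address [p].  A node
   occupies seven consecutive cells: the two child addresses, the length and
   the suffix range of its piece, and the total length (for searching by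
   pattern position) and the height (for rebalancing) of its subtree. *)
Fixpoint tree_at (h : heap) (p : nat) (t : tree) : Prop :=
  if t is Node l x r then
    [/\ 0 < p /\ p + 6 <= brk h,
        tree_at h (mem h p) l,
        tree_at h (mem h (p + 1)) r,
        [/\ mem h (p + 2) = x.1, mem h (p + 3) = x.2.1 & mem h (p + 4) = x.2.2]
      & mem h (p + 5) = total_length t /\ mem h (p + 6) = height t]
  else p = 0.

Definition stores_partition (h : heap) (p : nat) (P T : str) : Prop :=
  exists (ps : seq str) (t : tree),
    [/\ occurrence_partition P T ps,
        inorder t = [seq (size Q, SR Q T) | Q <- ps],
        balanced t
      & tree_at h p t].

(* Arguments passed to the update program: root address, position, kind of
   edit (1 for an insertion, 0 for a deletion) and inserted character. *)
Definition edit_args (root i : nat) (e : edit) : seq nat :=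
  match e with
  | Insert a => [:: root; i; 1; a]
  | Delete => [:: root; i; 0; 0]
  end.

(* Main.v *)
Require Import Defs.
From mathcomp Require Import all_boot all_order.
From mathcomp Require Import zify.
Import Order.TTheory.
Import Defs.

(* A substring of T given by an occurrence (q, m) gets its suffix range by two
   binary searches around ISA[q], deciding with a range minimum over LCP
   whether another suffix shares m characters with T_q.  An occurrence of a
   concatenation XY is found by a binary search in the suffix range of X, along
   which the ranks of the suffixes that remain after X are increasing; a single
   character is found by a binary search on first characters.

   To edit P, the piece containing the edited position is removed and what is
   left of it (with the inserted character) is pushed back fragment by
   fragment: pushing X merges X with the piece Y to its left if YX occurs in T.
   Pushing the piece that follows as well restores condition (2), because
   extending a piece to the left cannot make its concatenation with the next
   piece occur.  Since trees may share nodes in memory, the AVL operations are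
   persistent: they write only to freshly allocated cells. *)

Set Implicit Arguments.
Unset Strict Implicit.
Unset Printing Implicit Defensive.

(** * Suffix arrays and suffix ranges *)

(** Suffix ranges can be neither cut nor glued directly, so the range of a new piece is always
    recomputed from one occurrence of it. Each step is arranged to yield such an occurrence: the
    left end of the range of an old piece, shifted by an offset, serves its fragments, and the
    outcome of a search serves a merged piece or a character. The searches compare ranks, [LCP]
    values or single characters, so the lengths of the pieces do not enter the running time. An edit
    causes at most four pushes, hence a bounded number of tree operations and searches; since pieces
    are nonempty and the edited pattern never outgrows [T], the trees have height O(log |T|). Three
    levels are kept apart: lists of pieces, pure trees whose effect is read off [inorder], and the
    machine, which is executed symbolically against the pure functions. *)

Definition lexle : rel str := fun s t => (s <= t :> seqlexi nat)%O.

Lemma lexle_cons a s b t :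
  lexle (a :: s) (b :: t) = (a < b) || (a == b) && lexle s t.
Proof.
rewrite /lexle lexi_cons !leEnat -/(lexle s t) leq_eqVlt.
by case: ltngtP => //= ->; rewrite ?implybT.
Qed.

Lemma lexle_cons_nil a s : lexle (a :: s) [::] = false.
Proof. by rewrite /lexle lexis0. Qed.

Lemma lexle_refl : reflexive lexle.
Proof. by move=> s; rewrite /lexle lexx. Qed.

Lemma lexle_trans : transitive lexle.
Proof. by move=> t s u; apply: le_trans. Qed.

Lemma lexle_total : total lexle.
Proof. by move=> s t; apply: le_total. Qed.

Lemma lexle_anti s t : lexle s t -> lexle t s -> s = t.
Proof.
move=> st ts; apply: (@le_anti _ (seqlexi nat)).
by apply/andP; split; [exact: st | exact: ts].
Qed.

Lemma lexle_cat2l Q s t : lexle (Q ++ s) (Q ++ t) = lexle s t.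
Proof. by elim: Q => //= a Q IH; rewrite lexle_cons ltnn eqxx. Qed.

Lemma lcpC s t : lcp s t = lcp t s.
Proof. by elim: s t => [|a s IH] [|b t] //=; rewrite eq_sym IH. Qed.

Lemma leq_lcp m s t : (m <= lcp s t) = (m <= size s) && prefix (take m s) t.
Proof.
elim: m s t => [|m IH] [|a s] [|b t] //=; first by rewrite andbF.
by case: eqP => _ /=; rewrite ?andbF // !ltnS IH.
Qed.

Lemma lcp_trans m s t u : m <= lcp s t -> m <= lcp t u -> m <= lcp s u.
Proof.
elim: m s t u => [|m IH] [|a s] [|b t] [|c u] //=.
by case: (eqVneq a b) => // <-; case: (eqVneq a c) => // _; rewrite !ltnS; apply: IH.
Qed.

(** Two strings that agree on a prefix force it on everything sorted between them. This makes suffix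
    ranges intervals and, with [lcp_trans], reduces the lcp of two suffixes to a minimum over
    adjacent ranks. *)
Lemma lcp_between s t u : lexle s t -> lexle t u ->
  (lcp s u <= lcp s t) && (lcp s u <= lcp t u).
Proof.
elim: s t u => [|a s IH] [|b t] [|c u] //=; rewrite ?lexle_cons_nil //.
rewrite !lexle_cons; case: (eqVneq a c) => [<-|//].
case/orP=> [ab|/andP[/eqP <- st]].
  by case/orP=> [ba|/andP[/eqP ba]]; move: ab; rewrite ?ba ltnNge ?(ltnW ba) ?leqnn.
rewrite ltnn eqxx /=; exact: IH.
Qed.

Section SuffixArray.

Variable T : str.
Local Notation n := (size T).
Local Notation sa := (nth 0 (SA T)).
Local Notation isa := (nth 0 (ISA T)).
Local Notation suf p := (drop p T).

Lemma SA_perm : perm_eq (SA T) (iota 0 n).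
Proof. by rewrite /SA perm_sort. Qed.

Lemma size_SA : size (SA T) = n.
Proof. by rewrite (perm_size SA_perm) size_iota. Qed.

Lemma mem_SA p : (p \in SA T) = (p < n).
Proof. by rewrite (perm_mem SA_perm) mem_iota. Qed.

Lemma SA_lt i : i < n -> sa i < n.
Proof. by move=> ltin; rewrite -mem_SA mem_nth ?size_SA. Qed.

Lemma ISA_lt p : p < n -> isa p < n.
Proof.
move=> ltpn; rewrite (nth_map 0) ?size_iota // nth_iota // add0n.
by rewrite -size_SA index_mem mem_SA.
Qed.

Lemma SAK p : p < n -> sa (isa p) = p.
Proof.
move=> ltpn; rewrite (nth_map 0) ?size_iota // nth_iota // add0n.
by rewrite nth_index ?mem_SA.
Qed.

Lemma SA_sorted i j : i <= j < n -> lexle (suf (sa i)) (suf (sa j)).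
Proof.
case/andP=> leij ltjn; have ltin := leq_ltn_trans leij ltjn.
have tr : transitive (suffix_le T) by move=> y x z; apply: lexle_trans.
have rf : reflexive (suffix_le T) by move=> x; apply: lexle_refl.
apply: (sorted_leq_nth tr rf 0) => //; rewrite ?inE ?size_SA //.
by apply: sort_sorted => x y; apply: lexle_total.
Qed.

(** Distinct suffixes have distinct lengths, so if the ranks were in the wrong order, antisymmetry
    would identify [p] and [q]. *)
Lemma ISA_mono p q : p < n -> q < n -> lexle (suf p) (suf q) -> isa p <= isa q.
Proof.
move=> ltp ltq lepq; case: leqP => // ltqp.
have := @SA_sorted (isa q) (isa p).
rewrite ISA_lt // !SAK // (ltnW ltqp) => /(_ isT) leqp.
have /(congr1 size) := lexle_anti lepq leqp; rewrite !size_drop => eqpq.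
have eq_pq: p = q by lia.
by rewrite eq_pq ltnn in ltqp.
Qed.

Lemma size_LCP : size (LCP T) = n.-1.
Proof. by rewrite size_map size_iota. Qed.

Lemma nth_LCP i : i < n.-1 -> nth 0 (LCP T) i = lcp (suf (sa i)) (suf (sa i.+1)).
Proof. by move=> lti; rewrite (nth_map 0) ?size_iota // nth_iota. Qed.

Lemma occurs_at_lt Q p : Q <> [::] -> occurs_at Q T p -> p < n.
Proof. by case: Q => // a Q _; case: ltnP => // ?; rewrite /occurs_at drop_oversize. Qed.

Lemma occurs_at_cat X Y p :
  occurs_at (X ++ Y) T p = occurs_at X T p && occurs_at Y T (p + size X).
Proof.
rewrite /occurs_at addnC -drop_drop; move: (suf p) => s.
elim: X s => [|a X IH] [|b s] /=; rewrite ?drop0 ?prefix0s ?prefixs0 //.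
by rewrite IH andbA.
Qed.

Lemma occurs_at_size Q p : Q <> [::] -> occurs_at Q T p -> p + size Q <= n.
Proof.
move=> Q0 occ; have ltp := occurs_at_lt Q0 occ.
have : size Q <= size (suf p) by apply: size_prefix.
rewrite size_drop; lia.
Qed.

Lemma infixPn Q : Q <> [::] ->
  reflect (exists2 i, i < n & occurs_at Q T (sa i)) (infix Q T).
Proof.
move=> Q0; apply: (iffP (@infixP _ Q T)) => [[s [s' TE]]|[i lti /prefixP[s' sE]]].
  have occ: occurs_at Q T (size s) by rewrite /occurs_at TE drop_size_cat ?prefix_prefix.
  have ltp := occurs_at_lt Q0 occ.
  by exists (isa (size s)); rewrite ?SAK ?ISA_lt.
by exists (take (sa i) T), s'; rewrite -sE cat_take_drop.
Qed.

Lemma occurs_at_between Q i j k : i <= j <= k -> k < n ->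
  occurs_at Q T (sa i) -> occurs_at Q T (sa k) -> occurs_at Q T (sa j).
Proof.
case/andP=> leij lejk ltk oi ok.
(* As [Q] is a prefix of the suffix of rank [i], having [Q] as a prefix becomes a lower bound on the
   lcp with that suffix. *)
have H s : prefix Q s = (size Q <= lcp (suf (sa i)) s).
  case/prefixP: oi => s' ->.
  by rewrite leq_lcp size_cat leq_addr take_size_cat.
rewrite /occurs_at H in ok; rewrite /occurs_at.
have /andP[+ _] := lcp_between (@SA_sorted i j ltac:(lia)) (@SA_sorted j k ltac:(lia)).
move=> h; rewrite H; exact: leq_trans ok h.
Qed.

Lemma SR_correct l r Q : l < r <= n ->
  (forall i, i < n -> occurs_at Q T (sa i) = (l <= i < r)) -> SR Q T = (l, r).
Proof.
case/andP=> ltlr lern occE; rewrite /SR.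
have -> : SR_set Q T = iota l (r - l).
  rewrite /SR_set (_ : n = l + ((r - l) + (n - r))); last lia.
  rewrite iotaD filter_cat iotaD filter_cat.
  rewrite [X in X ++ _](_ : _ = [::]); last first.
    rewrite -(filter_pred0 (iota 0 l)); apply: eq_in_filter => i.
    by rewrite mem_iota => hi; rewrite occE /=; lia.
  rewrite [X in _ ++ _ ++ X](_ : _ = [::]) ?cats0 /=; last first.
    rewrite -(filter_pred0 (iota (0 + l + (r - l)) (n - r))); apply: eq_in_filter => i.
    by rewrite mem_iota => hi; rewrite occE /=; lia.
  rewrite -[RHS](filter_predT); apply: eq_in_filter => i.
  by rewrite mem_iota => hi; rewrite occE /=; lia.
have lastE k : last l (iota l.+1 k) = l + k.
  by elim: k (l) => [|k IH] j /=; rewrite ?addn0 // IH addSnnS.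
case E: (r - l) => [|k] /=; first by lia.
by rewrite lastE; congr (_, _); lia.
Qed.

Lemma SR_infix Q : Q <> [::] -> infix Q T ->
  let (l, r) := SR Q T in
  l < r <= n /\ forall i, i < n -> occurs_at Q T (sa i) = (l <= i < r).
Proof.
move=> Q0 /(infixPn Q0)[i0 lti0 occ0].
pose P i := (i < n) && occurs_at Q T (sa i).
have exP : exists i, P i by exists i0; rewrite /P lti0.
have bP i : P i -> i <= n by case/andP=> /ltnW.
have [l /andP[ltl ol] lmin] := ex_minnP exP.
have [r /andP[ltr or] rmax] := ex_maxnP exP bP.
have E i : i < n -> occurs_at Q T (sa i) = (l <= i < r.+1).
  move=> lti; apply/idP/idP=> [oi|/andP[h1 h2]].
    by rewrite lmin ?ltnS ?rmax /P ?lti.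
  by apply: (@occurs_at_between Q l i r); rewrite ?h1.
have lr: l < r.+1 <= n by rewrite ltr ltnS lmin // /P ltr or.
by rewrite (SR_correct lr E).
Qed.

Lemma SR_not_infix Q : Q <> [::] -> ~~ infix Q T -> SR Q T = (0, 0).
Proof.
move=> Q0 nQ; rewrite /SR (_ : SR_set Q T = [::]) //.
apply/eqP; rewrite -[_ == _]negbK -has_filter; apply: contra nQ => /hasP[i].
by rewrite mem_iota => /andP[_ lti] oi; apply/(infixPn Q0); exists i.
Qed.

(** For a string that does not occur the range is [(0, 0)], which contains no index, so both cases
    share one formula. *)
Lemma SR_occ Q i : Q <> [::] -> i < n ->
  occurs_at Q T (sa i) = ((SR Q T).1 <= i < (SR Q T).2).
Proof.
move=> Q0 lti; case: (boolP (infix Q T)) => iQ.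
  by have := SR_infix Q0 iQ; case: SR => l r [_ /(_ i lti)].
rewrite SR_not_infix //= ?ltn0 ?andbF; apply: contraNF iQ => oi.
by apply/(infixPn Q0); exists i.
Qed.

Lemma SR_le Q : Q <> [::] -> (SR Q T).2 <= n.
Proof.
move=> Q0; case: (boolP (infix Q T)) => iQ; last by rewrite SR_not_infix.
by have := SR_infix Q0 iQ; case: SR => l r [/andP[]].
Qed.

(** Lets the program recognise an absent piece by comparing the two stored endpoints. *)
Lemma infix_SR Q : Q <> [::] -> infix Q T = ((SR Q T).1 != (SR Q T).2).
Proof.
move=> Q0; case: (boolP (infix Q T)) => iQ; last by rewrite SR_not_infix.
by have := SR_infix Q0 iQ; case: SR => l r [/andP[lr _] _] /=; rewrite neq_ltn lr.
Qed.

Variable rmq : nat -> nat -> nat.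
Hypothesis rmqP : is_rmq (LCP T) rmq.

(** A bound on all adjacent lcps chains up by transitivity; conversely, the adjacent pair at the
    minimum lies between ranks [i] and [j]. The threshold form is all that the searches need. *)
Lemma leq_LCP_rmq m i j : i < j < n ->
  (m <= nth 0 (LCP T) (rmq i j)) = (m <= lcp (suf (sa i)) (suf (sa j))).
Proof.
case/andP=> ltij ltjn.
have [|/andP[h1 h2] hmin] := @rmqP i j; first by rewrite size_LCP; lia.
apply/idP/idP=> [hm|hm].
  have H k : i <= k < j -> m <= lcp (suf (sa k)) (suf (sa k.+1)).
    move=> hk; rewrite -nth_LCP; last lia.
    exact: leq_trans (hmin k hk).
  elim: j ltij {ltjn h1 h2 hmin hm} H => // j IH.
  rewrite ltnS leq_eqVlt => /orP[/eqP <-|ltij] H.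
    by apply: H; rewrite leqnn ltnSn.
  apply: lcp_trans (H j _); last by lia.
  by apply: IH => // k hk; apply: H; lia.
rewrite nth_LCP; last lia.
move: h1 h2; set k := rmq i j => h1 h2.
have /andP[a _] := lcp_between (@SA_sorted i k.+1 ltac:(lia))
  (@SA_sorted k.+1 j ltac:(lia)).
have /andP[_ b] := lcp_between (@SA_sorted i k ltac:(lia)) (@SA_sorted k k.+1 ltac:(lia)).
lia.
Qed.

(** Turns the two endpoints into threshold tests on either side of the rank of a known occurrence,
    ready for binary search. That rank is itself excluded because a range minimum is specified only
    between two different ranks. *)
Lemma SR_substring q m : 0 < m -> q + m <= n ->
  let (l, r) := SR (take m (suf q)) T in
  [/\ l <= isa q < r, r <= n,
      forall i, i < isa q -> (m <= nth 0 (LCP T) (rmq i (isa q))) = (l <= i)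
    & forall i, isa q < i < n -> (m <= nth 0 (LCP T) (rmq (isa q) i)) = (i < r)].
Proof.
move=> m0 leqm; set Q := take _ _.
have ltq : q < n by lia.
have Q0 : Q <> [::] by move/(congr1 size); rewrite size_takel ?size_drop /=; lia.
have occE i : occurs_at Q T (sa i) = (m <= lcp (suf q) (suf (sa i))).
  by rewrite leq_lcp size_drop (_ : m <= n - q); [|lia].
have ltk := ISA_lt ltq.
have := SR_occ Q0; have := SR_le Q0; case: SR => l r /= ler srE.
have hk : l <= isa q < r.
  by rewrite -srE // occE SAK // leq_lcp prefix_take size_drop; lia.
split=> // i hi.
  rewrite leq_LCP_rmq; last by lia.
  by rewrite lcpC SAK // -occE srE; lia.
rewrite leq_LCP_rmq; last by lia.
by rewrite SAK // -occE srE; lia.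
Qed.

(* One more than the inverse suffix array, so that the empty suffix, which
   precedes all others, gets rank 0. *)
Definition rank p := if p < n then (isa p).+1 else 0.

Lemma rank_mono p q : lexle (suf p) (suf q) -> rank p <= rank q.
Proof.
rewrite /rank; case: ifP => // ltp; case: (ltnP q n) => ltq le.
  by rewrite ltnS ISA_mono.
move: le; rewrite (drop_oversize ltq) (drop_nth 0 ltp).
by rewrite lexle_cons_nil.
Qed.

(** The shift by one in [rank] turns the range [l, r) into (l, r], from which the empty suffix, of
    rank 0, drops out by itself. *)
Lemma occurs_at_rank Q p : Q <> [::] ->
  occurs_at Q T p = ((SR Q T).1 < rank p <= (SR Q T).2).
Proof.
move=> Q0; rewrite /rank; case: (ltnP p n) => ltp.
  by rewrite !ltnS -SR_occ ?ISA_lt // SAK.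
rewrite ltn0; apply/negP=> /(occurs_at_lt Q0); lia.
Qed.

(** Removing the common prefix [X] from two suffixes keeps their order. The remainders may be empty,
    which is why [rank] is used here. *)
Lemma rank_shift_mono X i j : X <> [::] ->
  (SR X T).1 <= i <= j -> j < (SR X T).2 ->
  rank (sa i + size X) <= rank (sa j + size X).
Proof.
move=> X0 /andP[h1 h2] h3; have le := SR_le X0.
have oi : occurs_at X T (sa i) by rewrite SR_occ //; lia.
have oj : occurs_at X T (sa j) by rewrite SR_occ //; lia.
apply: rank_mono; have := @SA_sorted i j ltac:(lia).
rewrite ![sa _ + _]addnC -!drop_drop.
case/prefixP: oi => s ->; case/prefixP: oj => t ->.
by rewrite lexle_cat2l !drop_size_cat.
Qed.

(* [k] is the outcome of the search for the first suffix in the range of [X]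
   whose remainder after [X] is at least the first suffix starting with [Y]. *)
Lemma infix_cat_search X Y k : X <> [::] -> Y <> [::] ->
  (SR X T).1 <= k <= (SR X T).2 ->
  (forall i, (SR X T).1 <= i < k -> rank (sa i + size X) <= (SR Y T).1) ->
  (forall i, k <= i < (SR X T).2 -> (SR Y T).1 < rank (sa i + size X)) ->
  let b := (k < (SR X T).2) && (rank (sa k + size X) <= (SR Y T).2) in
  infix (X ++ Y) T = b /\ (b -> occurs_at (X ++ Y) T (sa k)).
Proof.
move=> X0 Y0 hk h1 h2 b; have XY0 : X ++ Y <> [::] by case: (X) X0.
have le := SR_le X0.
have occ : b -> occurs_at (X ++ Y) T (sa k).
  case/andP=> ltk hr; rewrite occurs_at_cat SR_occ // ?occurs_at_rank //; last lia.
  by rewrite ltk hr h2 //; lia.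
split=> //; apply/idP/idP=> [/(infixPn XY0)[i lti]|hb].
  rewrite occurs_at_cat SR_occ // occurs_at_rank // => /andP[hi /andP[hi1 hi2]].
  have leki : k <= i by case: leqP => // ltik; have := h1 i ltac:(lia); lia.
  have := @rank_shift_mono X k i X0 ltac:(lia) ltac:(lia); rewrite /b; lia.
apply/(infixPn XY0); exists k; [case/andP: hb; lia|exact: occ].
Qed.

Lemma char_mono i j : i <= j < n -> nth 0 T (sa i) <= nth 0 T (sa j).
Proof.
move=> hij; have := SA_sorted hij.
rewrite (drop_nth 0 (SA_lt (ltac:(lia) : i < n))).
rewrite (drop_nth 0 (SA_lt (ltac:(lia) : j < n))).
by rewrite lexle_cons => /orP[/ltnW|/andP[/eqP->]].
Qed.

Lemma mem_search a k : k <= n ->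
  (forall i, i < k -> nth 0 T (sa i) < a) ->
  (forall i, k <= i < n -> a <= nth 0 T (sa i)) ->
  (a \in T) = (k < n) && (nth 0 T (sa k) == a).
Proof.
move=> lek h1 h2; apply/idP/idP=> [aT|/andP[ltk /eqP<-]]; last by rewrite mem_nth ?SA_lt.
have ltp : index a T < n by rewrite index_mem.
have pE : nth 0 T (sa (isa (index a T))) = a by rewrite SAK ?nth_index.
have lti := ISA_lt ltp; move: (isa _) pE lti => i iE lti.
have leki : k <= i by case: leqP => // /h1; rewrite iE ltnn.
have ltk : k < n by apply: leq_ltn_trans lti.
rewrite ltk eqn_leq h2 ?leqnn ?ltk // andbT -iE char_mono //; lia.
Qed.

End SuffixArray.

(** * AVL trees addressed by position *)

Definition lengths (s : seq piece) : nat := sumn [seq x.1 | x <- s].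

Lemma lengths_cat s1 s2 : lengths (s1 ++ s2) = lengths s1 + lengths s2.
Proof. by rewrite /lengths map_cat sumn_cat. Qed.

Lemma lengths_cons x s : lengths (x :: s) = x.1 + lengths s.
Proof. by []. Qed.

Definition piece0 : piece := (0, (0, 0)).

(** This and the next three functions specify the tree operations on the in-order sequence of
    pieces. *)
Fixpoint pfind (s : seq piece) (pos : nat) : piece :=
  if s is x :: s' then if pos < x.1 then x else pfind s' (pos - x.1)
  else piece0.

Fixpoint poffset (s : seq piece) (pos : nat) : nat :=
  if s is x :: s' then if pos < x.1 then pos else poffset s' (pos - x.1)
  else 0.

Fixpoint pdelete (s : seq piece) (pos : nat) : seq piece :=
  if s is x :: s' then if pos < x.1 then s' else x :: pdelete s' (pos - x.1)
  else [::].

(** Meant for a [pos] on a boundary between pieces; strictly inside [y], truncated subtraction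
    places [x] right after [y]. *)
Fixpoint pinsert (s : seq piece) (pos : nat) (x : piece) : seq piece :=
  if s is y :: s' then
    if pos == 0 then x :: s else y :: pinsert s' (pos - y.1) x
  else [:: x].

Lemma pfind_cat s1 s2 pos :
  pfind (s1 ++ s2) pos =
  if pos < lengths s1 then pfind s1 pos else pfind s2 (pos - lengths s1).
Proof.
elim: s1 pos => [|x s1 IH] pos; first by rewrite subn0.
rewrite lengths_cons /= IH subnDA; case: ltnP => h1.
  by rewrite (leq_trans h1) ?leq_addr.
by rewrite ltn_subLR.
Qed.

Lemma poffset_cat s1 s2 pos :
  poffset (s1 ++ s2) pos =
  if pos < lengths s1 then poffset s1 pos else poffset s2 (pos - lengths s1).
Proof.
elim: s1 pos => [|x s1 IH] pos; first by rewrite subn0.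
rewrite lengths_cons /= IH subnDA; case: ltnP => h1.
  by rewrite (leq_trans h1) ?leq_addr.
by rewrite ltn_subLR.
Qed.

Lemma pdelete_cat s1 s2 pos :
  pdelete (s1 ++ s2) pos =
  if pos < lengths s1 then pdelete s1 pos ++ s2
  else s1 ++ pdelete s2 (pos - lengths s1).
Proof.
elim: s1 pos => [|x s1 IH] pos; first by rewrite subn0.
rewrite lengths_cons /= IH subnDA; case: ltnP => h1.
  by rewrite (leq_trans h1) ?leq_addr.
by rewrite ltn_subLR //; case: ifP.
Qed.

Lemma pinsert_cat s1 s2 pos x :
  pinsert (s1 ++ s2) pos x =
  if lengths s1 < pos then s1 ++ pinsert s2 (pos - lengths s1) x
  else pinsert s1 pos x ++ s2.
Proof.
elim: s1 pos => [|y s1 IH] pos.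
  by rewrite subn0; case: pos => //; case: s2.
rewrite lengths_cons /= IH subnDA; case: eqP => [-> //|/eqP].
rewrite -lt0n => p0; rewrite ltn_subRL; by case: ifP.
Qed.

Lemma pfind_mid s1 x s2 o : o < x.1 -> pfind (s1 ++ x :: s2) (lengths s1 + o) = x.
Proof. by move=> lto; rewrite pfind_cat ltnNge leq_addr addKn /= lto. Qed.

Lemma poffset_mid s1 x s2 o : o < x.1 -> poffset (s1 ++ x :: s2) (lengths s1 + o) = o.
Proof. by move=> lto; rewrite poffset_cat ltnNge leq_addr addKn /= lto. Qed.

Lemma pdelete_mid s1 x s2 o : o < x.1 ->
  pdelete (s1 ++ x :: s2) (lengths s1 + o) = s1 ++ s2.
Proof. by move=> lto; rewrite pdelete_cat ltnNge leq_addr addKn /= lto. Qed.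

(** A piece of length 0 at the end of [s1] would begin at the same position as [s2], and [x] would
    land before it; hence the positivity of the lengths. *)
Lemma pinsert_mid s1 x s2 : all (fun y => 0 < y.1) s1 ->
  pinsert (s1 ++ s2) (lengths s1) x = s1 ++ x :: s2.
Proof.
elim: s1 => [|y s1 IH] /=; first by case: s2.
by case/andP=> y0 /IH {}IH; rewrite lengths_cons addn_eq0 eqn0Ngt y0 /= addKn IH.
Qed.

(* The branches returning [Leaf] are unreachable. *)
Definition tbalance (l : tree) (x : piece) (r : tree) : tree :=
  if (height r).+1 < height l then
    if l is Node ll lx lr then
      if height ll < height lr then
        if lr is Node lrl lrx lrr then
          Node (Node ll lx lrl) lrx (Node lrr x r)
        else Leaf
      else Node ll lx (Node lr x r)
    else Leaf
  else if (height l).+1 < height r then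
    if r is Node rl rx rr then
      if height rr < height rl then
        if rl is Node rll rlx rlr then
          Node (Node l x rll) rlx (Node rlr rx rr)
        else Leaf
      else Node (Node l x rl) rx rr
    else Leaf
  else Node l x r.

Lemma inorder_tbalance l x r :
  inorder (tbalance l x r) = inorder l ++ x :: inorder r.
Proof.
rewrite /tbalance; case: ltnP => h1.
  case: l h1 => [|ll lx lr] // h1; case: ltnP => h2; last by rewrite /= -catA.
  by case: lr h1 h2 => //= lrl lrx lrr _ _; rewrite -?catA /= -?catA.
case: ltnP => // h2; case: r h1 h2 => [|rl rx rr] // h1 h2.
case: ltnP => h3; last by rewrite /= -?catA.
by case: rl h1 h2 h3 => //= rll rlx rlr _ _ _; rewrite -?catA /= -?catA.
Qed.

(** A height difference of 2 is what one insertion or deletion can cause. The height bounds leave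
    one unit of slack, which only a rotation uses; the exact height in the last clause is what makes
    the bounds for insertion and deletion inductive. *)
Lemma balanced_tbalance l x r :
  balanced l -> balanced r ->
  height l <= (height r).+2 -> height r <= (height l).+2 ->
  [/\ balanced (tbalance l x r),
      maxn (height l) (height r) <= height (tbalance l x r)
        <= (maxn (height l) (height r)).+1
    & height l <= (height r).+1 -> height r <= (height l).+1 ->
      height (tbalance l x r) = (maxn (height l) (height r)).+1].
Proof.
rewrite /tbalance => bl br hl hr; case: ifP => c1 /=.
  case: l bl hl hr c1 => [|ll lx lr] //= /and4P[b1 b2 b3 b4] hl hr c1.
  case: ifP => c2; last by split; simpl in *; [rewrite b3 b4 br|..]; lia.
  case: lr b1 b2 b4 hl hr c1 c2 => [|lrl lrx lrr] //=.
  move=> b1 b2 /and4P[b4 b5 b6 b7] hl hr c1 c2.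
  by split; simpl in *; [rewrite b3 b6 b7 br|..]; lia.
case: ifP => c2 /=; last by split=> //; [rewrite bl br|]; lia.
case: r br hl hr c1 c2 => [|rl rx rr] //= /and4P[b1 b2 b3 b4] hl hr c1 c2.
case: ifP => c3; last by split; simpl in *; [rewrite b3 b4 bl|..]; lia.
case: rl b1 b2 b3 hl hr c1 c2 c3 => [|rll rlx rlr] //=.
move=> b1 b2 /and4P[b3 b5 b6 b7] hl hr c1 c2 c3.
by split; simpl in *; [rewrite b4 b6 b7 bl|..]; lia.
Qed.

Fixpoint tinsert (t : tree) (pos : nat) (x : piece) : tree :=
  if t is Node l y r then
    if total_length l < pos then
      tbalance l y (tinsert r (pos - (total_length l + y.1)) x)
    else tbalance (tinsert l pos x) y r
  else Node Leaf x Leaf.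

Fixpoint tmin (t : tree) : piece :=
  if t is Node l x _ then if l is Leaf then x else tmin l else piece0.

Fixpoint tdelete_min (t : tree) : tree :=
  if t is Node l x r then
    if l is Leaf then r else tbalance (tdelete_min l) x r
  else Leaf.

Definition tmerge (l r : tree) : tree :=
  if r is Leaf then l else tbalance l (tmin r) (tdelete_min r).

Fixpoint tdelete (t : tree) (pos : nat) : tree :=
  if t is Node l x r then
    if pos < total_length l then tbalance (tdelete l pos) x r
    else if pos < total_length l + x.1 then tmerge l r
    else tbalance l x (tdelete r (pos - (total_length l + x.1)))
  else Leaf.

Lemma total_lengthE t : total_length t = lengths (inorder t).
Proof. by []. Qed.

Lemma total_length_node l x r :
  total_length (Node l x r) = total_length l + (x.1 + total_length r).
Proof. by rewrite !total_lengthE /= lengths_cat lengths_cons. Qed.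

Lemma inorder_tinsert t pos x : inorder (tinsert t pos x) = pinsert (inorder t) pos x.
Proof.
elim: t pos => [|l IHl y r IHr] pos //=.
rewrite pinsert_cat -total_lengthE; case: ltnP => h; rewrite inorder_tbalance.
  by rewrite IHr /= subnDA subn_eq0 leqNgt h.
by rewrite IHl.
Qed.

Lemma inorder_tdelete_min t : t <> Leaf ->
  inorder t = tmin t :: inorder (tdelete_min t).
Proof.
elim: t => // l IHl x r _ _; case: l IHl => //= ll lx lr IHl.
by rewrite inorder_tbalance /= IHl.
Qed.

Lemma inorder_tmerge l r : inorder (tmerge l r) = inorder l ++ inorder r.
Proof.
case: r => [|rl x rr]; first by rewrite /= cats0.
by rewrite [tmerge _ _]/(tbalance _ _ _) inorder_tbalance -inorder_tdelete_min.
Qed.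

Lemma inorder_tdelete t pos : inorder (tdelete t pos) = pdelete (inorder t) pos.
Proof.
elim: t pos => [|l IHl y r IHr] pos //=.
rewrite pdelete_cat -total_lengthE; case: ltnP => h.
  by rewrite inorder_tbalance IHl.
rewrite /= ltn_subLR //; case: ltnP => h'; first by rewrite inorder_tmerge.
by rewrite inorder_tbalance IHr subnDA.
Qed.

Lemma balanced_tinsert t pos x : balanced t ->
  balanced (tinsert t pos x) /\ height t <= height (tinsert t pos x) <= (height t).+1.
Proof.
elim: t pos => [|l IHl y r IHr] pos //= /and4P[h1 h2 bl br].
case: ifP => _.
  have [b h] := IHr (pos - (total_length l + y.1)) br.
  have [] := @balanced_tbalance l y _ bl b; [lia|lia|move=> -> h3 h4; split=> //; lia].
have [b h] := IHl pos bl.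
have [] := @balanced_tbalance _ y r b br; [lia|lia|move=> -> h3 h4; split=> //; lia].
Qed.

Lemma balanced_tdelete_min t : balanced t ->
  balanced (tdelete_min t) /\ (height t).-1 <= height (tdelete_min t) <= height t.
Proof.
elim: t => [|l IHl x r _] //= /and4P[h1 h2 bl br].
case: l IHl h1 h2 bl => [|ll lx lr] IHl h1 h2 bl; first by split=> //=; lia.
have [b h] := IHl bl; move: h1 h2 bl b h.
set l := Node ll lx lr; change (tdelete_min (Node ll lx lr)) with (tdelete_min l).
move=> h1 h2 bl b h; clearbody l.
have [] := @balanced_tbalance _ x r b br; [lia|lia|move=> -> h3 h4; split=> //; lia].
Qed.

Lemma balanced_tmerge l r : balanced l -> balanced r ->
  height l <= (height r).+1 -> height r <= (height l).+1 ->
  balanced (tmerge l r) /\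
  maxn (height l) (height r) <= height (tmerge l r) <= (maxn (height l) (height r)).+1.
Proof.
rewrite /tmerge => bl br h1 h2; case: r br h1 h2 => [|rl x rr] br h1 h2.
  by split=> //=; simpl in *; lia.
have [b h] := balanced_tdelete_min br; move: br b h h1 h2.
set r := Node rl x rr => br b h h1 h2; clearbody r.
have [] := @balanced_tbalance l (tmin r) _ bl b; [lia|lia|move=> -> h3 h4; split=> //; lia].
Qed.

Lemma balanced_tdelete t pos : balanced t ->
  balanced (tdelete t pos) /\ (height t).-1 <= height (tdelete t pos) <= height t.
Proof.
elim: t pos => [|l IHl y r IHr] pos //= /and4P[h1 h2 bl br].
case: ifP => _.
  have [b h] := IHl pos bl.
  have [] := @balanced_tbalance _ y r b br; [lia|lia|move=> -> h3 h4; split=> //; lia].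
case: ifP => _.
  by have [b h] := balanced_tmerge bl br h1 h2; split=> //; lia.
have [b h] := IHr (pos - (total_length l + y.1)) br.
have [] := @balanced_tbalance l y _ bl b; [lia|lia|move=> -> h3 h4; split=> //; lia].
Qed.

(** Both children are at most two levels lower than the node, so every two levels double the count.
    The Fibonacci bound would only improve the constant. *)
Lemma balanced_size t : balanced t -> 2 ^ (height t)./2 <= (size (inorder t)).+1.
Proof.
elim: t => [|l IHl y r IHr] //= /and4P[h1 h2 /IHl {}IHl /IHr {}IHr].
rewrite size_cat /=.
have e a b : a <= b -> 2 ^ a <= 2 ^ b by move=> ?; rewrite leq_exp2l.
set m := maxn _ _; case: (ltnP m 1) => hm.
  by have -> : m = 0 by lia.
case E: (uphalf m) => [|a]; first by lia.
have := e a (height l)./2 ltac:(lia); have := e a (height r)./2 ltac:(lia).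
rewrite expnS; lia.
Qed.

Lemma balanced_height t N : 0 < N -> balanced t -> size (inorder t) <= N ->
  height t <= 2 * (trunc_log 2 N).+2.
Proof.
move=> N0 /balanced_size h1 h2.
have h3 : 2 ^ (height t)./2 < 2 ^ (trunc_log 2 N).+2.
  have := trunc_log_ltn N (ltnSn 1); rewrite [2 ^ _.+2]expnS; lia.
move: h3; rewrite ltn_exp2l //; lia.
Qed.

(** * The program and its execution rules *)

Local Notation "x +e y" := (Bin Add x y) (at level 50, left associativity).
Local Notation "x -e y" := (Bin Sub x y) (at level 50, left associativity).
Local Notation "x <e y" := (Bin Lt x y) (at level 70).
Local Notation "x =e y" := (Bin Eq x y) (at level 70).

Local Notation p_mk := 1 (only parsing).
Local Notation p_balance := 2 (only parsing).
Local Notation p_insert := 3 (only parsing).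
Local Notation p_min := 4 (only parsing).
Local Notation p_delete_min := 5 (only parsing).
Local Notation p_delete := 6 (only parsing).
Local Notation p_find := 7 (only parsing).
Local Notation p_offset := 8 (only parsing).
Local Notation p_search_char := 9 (only parsing).
Local Notation p_search_cat := 10 (only parsing).
Local Notation p_search_left := 11 (only parsing).
Local Notation p_search_right := 12 (only parsing).
Local Notation p_push := 13 (only parsing).
Local Notation p_push_sub := 14 (only parsing).
Local Notation p_push_char := 15 (only parsing).

Definition cell (x k : nat) : expr := Read (Var x +e Const k).
Definition length_of (x : nat) : expr := If (Var x) (cell x 5) (Const 0).
Definition height_of (x : nat) : expr := If (Var x) (cell x 6) (Const 0).

(** The only procedure that allocates or writes, so persistence is checked once, in [mk_spec].
    Register 10 merely receives the results of the writes. *)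
Definition mk_body : expr :=
  Let 5 (length_of 0 +e (Var 2 +e length_of 1))
 (Let 6 (height_of 0)
 (Let 7 (height_of 1)
 (Let 8 (If (Var 6 <e Var 7) (Var 7) (Var 6) +e Const 1)
 (Let 9 (Alloc 7)
 (Let 10 (Write (Var 9) (Var 0))
 (Let 10 (Write (Var 9 +e Const 1) (Var 1))
 (Let 10 (Write (Var 9 +e Const 2) (Var 2))
 (Let 10 (Write (Var 9 +e Const 3) (Var 3))
 (Let 10 (Write (Var 9 +e Const 4) (Var 4))
 (Let 10 (Write (Var 9 +e Const 5) (Var 5))
 (Let 10 (Write (Var 9 +e Const 6) (Var 8))
 (Var 9)))))))))))).

Definition balance_body : expr :=
  Let 5 (height_of 0)
 (Let 6 (height_of 1)
 (If (Var 6 +e Const 1 <e Var 5)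
   (Let 7 (Read (Var 0))
   (Let 8 (cell 0 1)
   (Let 9 (cell 0 2)
   (Let 10 (cell 0 3)
   (Let 11 (cell 0 4)
   (Let 12 (height_of 7)
   (Let 13 (height_of 8)
   (If (Var 12 <e Var 13)
     (Let 14 (Read (Var 8))
     (Let 15 (cell 8 1)
     (Let 16 (cell 8 2)
     (Let 17 (cell 8 3)
     (Let 18 (cell 8 4)
     (Call p_mk [:: Call p_mk [:: Var 7; Var 14; Var 9; Var 10; Var 11];
                    Call p_mk [:: Var 15; Var 1; Var 2; Var 3; Var 4];
                    Var 16; Var 17; Var 18]))))))
     (Call p_mk [:: Var 7; Call p_mk [:: Var 8; Var 1; Var 2; Var 3; Var 4];
                    Var 9; Var 10; Var 11])))))))))
 (If (Var 5 +e Const 1 <e Var 6)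
   (Let 7 (Read (Var 1))
   (Let 8 (cell 1 1)
   (Let 9 (cell 1 2)
   (Let 10 (cell 1 3)
   (Let 11 (cell 1 4)
   (Let 12 (height_of 7)
   (Let 13 (height_of 8)
   (If (Var 13 <e Var 12)
     (Let 14 (Read (Var 7))
     (Let 15 (cell 7 1)
     (Let 16 (cell 7 2)
     (Let 17 (cell 7 3)
     (Let 18 (cell 7 4)
     (Call p_mk [:: Call p_mk [:: Var 0; Var 14; Var 2; Var 3; Var 4];
                    Call p_mk [:: Var 15; Var 8; Var 9; Var 10; Var 11];
                    Var 16; Var 17; Var 18]))))))
     (Call p_mk [:: Call p_mk [:: Var 0; Var 7; Var 2; Var 3; Var 4]; Var 8;
                    Var 9; Var 10; Var 11])))))))))
   (Call p_mk [:: Var 0; Var 1; Var 2; Var 3; Var 4])))).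

Definition insert_body : expr :=
  If (Var 0)
   (Let 5 (Read (Var 0))
   (Let 6 (cell 0 1)
   (Let 7 (cell 0 2)
   (Let 8 (cell 0 3)
   (Let 9 (cell 0 4)
   (Let 10 (length_of 5)
   (If (Var 10 <e Var 1)
     (Call p_balance
       [:: Var 5;
           Call p_insert [:: Var 6; Var 1 -e (Var 10 +e Var 7);
                             Var 2; Var 3; Var 4];
           Var 7; Var 8; Var 9])
     (Call p_balance
       [:: Call p_insert [:: Var 5; Var 1; Var 2; Var 3; Var 4];
           Var 6; Var 7; Var 8; Var 9]))))))))
   (Call p_mk [:: Const 0; Const 0; Var 2; Var 3; Var 4]).

Definition min_body : expr :=
  Let 1 (Read (Var 0)) (If (Var 1) (Call p_min [:: Var 1]) (Var 0)).

Definition delete_min_body : expr :=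
  Let 1 (Read (Var 0))
 (Let 2 (cell 0 1)
 (If (Var 1)
   (Let 3 (cell 0 2)
   (Let 4 (cell 0 3)
   (Let 5 (cell 0 4)
   (Call p_balance [:: Call p_delete_min [:: Var 1]; Var 2;
                       Var 3; Var 4; Var 5]))))
   (Var 2))).

Definition delete_body : expr :=
  If (Var 0)
   (Let 2 (Read (Var 0))
   (Let 3 (cell 0 1)
   (Let 4 (cell 0 2)
   (Let 5 (cell 0 3)
   (Let 6 (cell 0 4)
   (Let 7 (length_of 2)
   (If (Var 1 <e Var 7)
     (Call p_balance [:: Call p_delete [:: Var 2; Var 1]; Var 3;
                         Var 4; Var 5; Var 6])
   (If (Var 1 <e Var 7 +e Var 4)
     (If (Var 3)
       (Let 8 (Call p_min [:: Var 3])
       (Let 9 (cell 8 2)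
       (Let 10 (cell 8 3)
       (Let 11 (cell 8 4)
       (Call p_balance [:: Var 2; Call p_delete_min [:: Var 3];
                           Var 9; Var 10; Var 11])))))
       (Var 2))
     (Call p_balance
       [:: Var 2; Call p_delete [:: Var 3; Var 1 -e (Var 7 +e Var 4)];
           Var 4; Var 5; Var 6])))))))))
   (Const 0).

Definition find_body : expr :=
  Let 2 (Read (Var 0))
 (Let 3 (length_of 2)
 (Let 4 (cell 0 2)
 (If (Var 1 <e Var 3)
   (Call p_find [:: Var 2; Var 1])
 (If (Var 1 <e Var 3 +e Var 4)
   (Var 0)
   (Call p_find [:: cell 0 1; Var 1 -e (Var 3 +e Var 4)]))))).

(** A procedure returns a single number, so the piece (as the address of its node) and the offset
    inside it take two descents. *)
Definition offset_body : expr :=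
  Let 2 (Read (Var 0))
 (Let 3 (length_of 2)
 (Let 4 (cell 0 2)
 (If (Var 1 <e Var 3)
   (Call p_offset [:: Var 2; Var 1])
 (If (Var 1 <e Var 3 +e Var 4)
   (Var 1 -e Var 3)
   (Call p_offset [:: cell 0 1; Var 1 -e (Var 3 +e Var 4)]))))).

(* Registers 0 and 1 delimit the range that is searched for the first index
   (register 4) passing [test]; 2 and 3 are parameters of [test]. *)
Definition search_body (f : nat) (test : expr) : expr :=
  If (Var 0 <e Var 1)
   (Let 4 (Half (Var 0 +e Var 1))
   (If test
     (Call f [:: Var 0; Var 4; Var 2; Var 3])
     (Call f [:: Var 4 +e Const 1; Var 1; Var 2; Var 3])))
   (Var 0).

Definition rank_of (x : nat) : expr :=
  If (Var x <e TextSize) (TextISA (Var x) +e Const 1) (Const 0).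

(** The machine has only a strict comparison; adding 1 on the right makes it weak. *)
Definition char_test : expr := Var 2 <e TextChar (TextSA (Var 4)) +e Const 1.
Definition cat_test : expr :=
  Let 5 (TextSA (Var 4) +e Var 2) (Var 3 <e rank_of 5).
Definition left_test : expr :=
  Var 3 <e TextLCP (TextRMQ (Var 4) (Var 2)) +e Const 1.
Definition right_test : expr := TextLCP (TextRMQ (Var 2) (Var 4)) <e Var 3.

(** Registers [x] and [y] hold a position and a length. If no rank below that of the position
    passes, the search returns that rank, which is then the left end. *)
Definition range_left (x y : nat) : expr :=
  Call p_search_left [:: Const 0; TextISA (Var x); TextISA (Var x); Var y].
Definition range_right (x y : nat) : expr :=
  Call p_search_right
    [:: TextISA (Var x) +e Const 1; TextSize; TextISA (Var x); Var y].

(** Registers 2 to 4 hold the pushed piece and register 1 its position in the pattern. At position 0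
    there is no left neighbour; otherwise the preceding position lies in it. The inner [If] is a
    conjunction: the suffix at the returned index matters only if the index is inside the range. *)
Definition push_body : expr :=
  If (Var 1)
   (Let 5 (Call p_find [:: Var 0; Var 1 -e Const 1])
   (Let 6 (cell 5 2)
   (Let 7 (cell 5 3)
   (Let 8 (cell 5 4)
   (Let 9 (Call p_search_cat [:: Var 7; Var 8; Var 6; Var 3])
   (Let 10 (TextSA (Var 9))
   (Let 11 (Var 10 +e Var 6)
   (If (If (Var 9 <e Var 8) (rank_of 11 <e Var 4 +e Const 1) (Const 0))
     (Let 12 (Var 6 +e Var 2)
     (Call p_insert
       [:: Call p_delete [:: Var 0; Var 1 -e Const 1]; Var 1 -e Var 6;
           Var 12; range_left 10 12; range_right 10 12]))
     (Call p_insert [:: Var 0; Var 1; Var 2; Var 3; Var 4])))))))))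
   (Call p_insert [:: Var 0; Var 1; Var 2; Var 3; Var 4]).

(** Registers 2, 3 and 4 hold the node of a piece and the offset and length of the fragment to push.
    Equal endpoints mean an absent character, whose range is passed on unchanged. *)
Definition push_sub_body : expr :=
  If (Var 4)
   (Let 5 (cell 2 3)
   (If (Var 5 =e cell 2 4)
     (Call p_push [:: Var 0; Var 1; Var 4; Var 5; Var 5])
     (Let 6 (TextSA (Var 5) +e Var 3)
     (Call p_push [:: Var 0; Var 1; Var 4; range_left 6 4; range_right 6 4]))))
   (Var 0).

Definition push_char_body : expr :=
  Let 3 (Call p_search_char [:: Const 0; TextSize; Var 2; Const 0])
 (Let 4 (TextSA (Var 3))
 (Let 5 (Const 1)
 (If (If (Var 3 <e TextSize) (TextChar (Var 4) =e Var 2) (Const 0))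
   (Call p_push [:: Var 0; Var 1; Const 1; range_left 4 5; range_right 4 5])
   (Call p_push [:: Var 0; Var 1; Const 1; Const 0; Const 0])))).

(** Register 7 is where the right remainder starts inside the split piece: a deletion skips one
    character, an insertion none. Register 9 is the position at which the next piece begins. The
    last call serves an insertion after the last character, including the case of an empty tree. *)
Definition main_body : expr :=
  If (Var 1 <e length_of 0)
   (Let 4 (Call p_find [:: Var 0; Var 1])
   (Let 5 (Call p_offset [:: Var 0; Var 1])
   (Let 6 (cell 4 2)
   (Let 7 (Var 5 +e (Const 1 -e Var 2))
   (Let 8 (Call p_push_sub [:: Call p_delete [:: Var 0; Var 1]; Var 1 -e Var 5;
                               Var 4; Const 0; Var 5])
   (Let 8 (If (Var 2) (Call p_push_char [:: Var 8; Var 1; Var 3]) (Var 8))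
   (Let 8 (Call p_push_sub [:: Var 8; Var 1 +e Var 2; Var 4; Var 7;
                               Var 6 -e Var 7])
   (Let 9 ((Var 1 +e Var 2) +e (Var 6 -e Var 7))
   (If (Var 9 <e length_of 8)
     (Let 10 (Call p_find [:: Var 8; Var 9])
     (Let 11 (cell 10 2)
     (Let 12 (cell 10 3)
     (Let 13 (cell 10 4)
     (Call p_push [:: Call p_delete [:: Var 8; Var 9]; Var 9;
                      Var 11; Var 12; Var 13])))))
     (Var 8))))))))))
   (Call p_push_char [:: Var 0; Var 1; Var 3]).

Definition update_program : program :=
  [:: main_body; mk_body; balance_body; insert_body; min_body; delete_min_body;
      delete_body; find_body; offset_body;
      search_body p_search_char char_test; search_body p_search_cat cat_test;
      search_body p_search_left left_test; search_body p_search_right right_test;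
      push_body; push_sub_body; push_char_body].

(** Formal persistence: whatever is stored in [h] remains stored in [h'], so addresses kept in
    registers survive later updates. *)
Definition hext (h h' : heap) : Prop :=
  brk h <= brk h' /\ forall p, p <= brk h -> mem h' p = mem h p.

Lemma hext_trans h2 h1 h3 : hext h1 h2 -> hext h2 h3 -> hext h1 h3.
Proof.
move=> [le12 eq12] [le23 eq23]; split; first exact: leq_trans le23.
by move=> p lep; rewrite eq23 ?eq12 // (leq_trans lep).
Qed.

Lemma tree_at_node h p l x r :
  tree_at h p (Node l x r) ->
  [/\ 0 < p /\ p + 6 <= brk h, tree_at h (mem h p) l,
      tree_at h (mem h (p + 1)) r,
      [/\ mem h (p + 2) = x.1, mem h (p + 3) = x.2.1 & mem h (p + 4) = x.2.2]
    & mem h (p + 5) = total_length (Node l x r) /\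
      mem h (p + 6) = height (Node l x r)].
Proof. by []. Qed.

Lemma tree_at_ext h h' p t : hext h h' -> tree_at h p t -> tree_at h' p t.
Proof.
case=> le eq; elim: t p => [|l IHl x r IHr] p //= [[p0 pb] Hl Hr e1 e2].
have eqm k : k <= 6 -> mem h' (p + k) = mem h (p + k) by move=> ?; apply: eq; lia.
have eq0 : mem h' p = mem h p by apply: eq; lia.
split; rewrite ?eq0 ?eqm //; try exact: IHl; try exact: IHr.
by split=> //; exact: leq_trans le.
Qed.

(* [set_nth 0] with the padding expressed in a form that [cbn] computes. *)
Fixpoint set_register (env : seq nat) (x v : nat) : seq nat :=
  match x, env with
  | 0, [::] => [:: v]
  | 0, _ :: env' => v :: env'
  | x'.+1, [::] => 0 :: set_register [::] x' v
  | x'.+1, a :: env' => a :: set_register env' x' v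
  end.

Lemma set_registerE env x v : set_nth 0 env x v = set_register env x v.
Proof.
elim: x env => [|x IH] [|a env] //=; rewrite -IH //.
by rewrite set_nth_nil.
Qed.

Section Execution.

Variables (T : str) (rmq : nat -> nat -> nat).
Local Notation prog := update_program.
Local Notation proc f := (nth (Const 0) prog f).

(** Total correctness in predicate-transformer form, with the cost passed to the postcondition. The
    rules below execute a program forwards by nesting continuations; the costs are added up only at
    the end. *)
Definition ev env h e (Q : heap -> nat -> nat -> Prop) : Prop :=
  exists h' v n, eval T rmq prog env h e h' v n /\ Q h' v n.

Definition evs env h es (Q : heap -> seq nat -> nat -> Prop) : Prop :=
  exists h' vs n, evals T rmq prog env h es h' vs n /\ Q h' vs n.

Lemma ev_Var env h x (Q : heap -> nat -> nat -> Prop) :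
  Q h (nth 0 env x) 1 -> ev env h (Var x) Q.
Proof. by do 3 eexists; split; [constructor|]. Qed.

Lemma ev_Const env h k (Q : heap -> nat -> nat -> Prop) :
  Q h k 1 -> ev env h (Const k) Q.
Proof. by do 3 eexists; split; [constructor|]. Qed.

Lemma ev_Bin env h o e1 e2 Q :
  ev env h e1 (fun h1 v1 n1 => ev env h1 e2 (fun h2 v2 n2 =>
    Q h2 (do_binop o v1 v2) (n1 + n2).+1)) ->
  ev env h (Bin o e1 e2) Q.
Proof.
move=> [h1 [v1 [n1 [E1 [h2 [v2 [n2 [E2 q]]]]]]]].
by do 3 eexists; split; [econstructor; [exact: E1|exact: E2]|].
Qed.

Lemma ev_Half env h e Q :
  ev env h e (fun h1 v n => Q h1 v./2 n.+1) -> ev env h (Half e) Q.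
Proof.
move=> [h1 [v1 [n1 [E1 q]]]].
by do 3 eexists; split; [econstructor; exact: E1|].
Qed.

Lemma ev_Let env h x e1 e2 Q :
  ev env h e1 (fun h1 v1 n1 => ev (set_register env x v1) h1 e2 (fun h2 v2 n2 =>
    Q h2 v2 (n1 + n2).+1)) ->
  ev env h (Let x e1 e2) Q.
Proof.
move=> [h1 [v1 [n1 [E1 [h2 [v2 [n2 [E2 q]]]]]]]]; rewrite -set_registerE in E2.
by do 3 eexists; split; [econstructor; [exact: E1|exact: E2]|].
Qed.

Lemma ev_If env h e e1 e2 Q :
  ev env h e (fun h1 v n1 => ev env h1 (if v != 0 then e1 else e2)
    (fun h2 w n2 => Q h2 w (n1 + n2).+1)) ->
  ev env h (If e e1 e2) Q.
Proof.
move=> [h1 [v1 [n1 [E1 [h2 [v2 [n2 [E2 q]]]]]]]].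
by do 3 eexists; split; [econstructor; [exact: E1|exact: E2]|].
Qed.

Lemma ev_Call env h f es Q :
  evs env h es (fun h1 vs n1 => ev vs h1 (proc f) (fun h2 v n2 =>
    Q h2 v (n1 + n2).+1)) ->
  ev env h (Call f es) Q.
Proof.
move=> [h1 [v1 [n1 [E1 [h2 [v2 [n2 [E2 q]]]]]]]].
by do 3 eexists; split; [econstructor; [exact: E1|exact: E2]|].
Qed.

Lemma ev_Read env h e Q :
  ev env h e (fun h1 p n => Q h1 (mem h1 p) n.+1) -> ev env h (Read e) Q.
Proof.
move=> [h1 [v1 [n1 [E1 q]]]].
by do 3 eexists; split; [econstructor; exact: E1|].
Qed.

Lemma ev_Write env h e1 e2 Q :
  ev env h e1 (fun h1 p n1 => ev env h1 e2 (fun h2 v n2 =>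
    Q (update h2 p v) 0 (n1 + n2).+1)) ->
  ev env h (Write e1 e2) Q.
Proof.
move=> [h1 [v1 [n1 [E1 [h2 [v2 [n2 [E2 q]]]]]]]].
by do 3 eexists; split; [econstructor; [exact: E1|exact: E2]|].
Qed.

Lemma ev_Alloc env h k (Q : heap -> nat -> nat -> Prop) :
  Q (Heap (mem h) (brk h + k)) (brk h).+1 k.+1 -> ev env h (Alloc k) Q.
Proof. by do 3 eexists; split; [constructor|]. Qed.

Lemma ev_TextSize env h (Q : heap -> nat -> nat -> Prop) :
  Q h (size T) 1 -> ev env h TextSize Q.
Proof. by do 3 eexists; split; [constructor|]. Qed.

Lemma ev_TextChar env h e Q :
  ev env h e (fun h1 i n => Q h1 (nth 0 T i) n.+1) -> ev env h (TextChar e) Q.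
Proof.
move=> [h1 [v1 [n1 [E1 q]]]].
by do 3 eexists; split; [econstructor; exact: E1|].
Qed.

Lemma ev_TextSA env h e Q :
  ev env h e (fun h1 i n => Q h1 (nth 0 (SA T) i) n.+1) -> ev env h (TextSA e) Q.
Proof.
move=> [h1 [v1 [n1 [E1 q]]]].
by do 3 eexists; split; [econstructor; exact: E1|].
Qed.

Lemma ev_TextISA env h e Q :
  ev env h e (fun h1 i n => Q h1 (nth 0 (ISA T) i) n.+1) ->
  ev env h (TextISA e) Q.
Proof.
move=> [h1 [v1 [n1 [E1 q]]]].
by do 3 eexists; split; [econstructor; exact: E1|].
Qed.

Lemma ev_TextLCP env h e Q :
  ev env h e (fun h1 i n => Q h1 (nth 0 (LCP T) i) n.+1) ->
  ev env h (TextLCP e) Q.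
Proof.
move=> [h1 [v1 [n1 [E1 q]]]].
by do 3 eexists; split; [econstructor; exact: E1|].
Qed.

Lemma ev_TextRMQ env h e1 e2 Q :
  ev env h e1 (fun h1 i n1 => ev env h1 e2 (fun h2 j n2 =>
    Q h2 (rmq i j) (n1 + n2).+1)) ->
  ev env h (TextRMQ e1 e2) Q.
Proof.
move=> [h1 [v1 [n1 [E1 [h2 [v2 [n2 [E2 q]]]]]]]].
by do 3 eexists; split; [econstructor; [exact: E1|exact: E2]|].
Qed.

Lemma evs_nil env h (Q : heap -> seq nat -> nat -> Prop) :
  Q h [::] 0 -> evs env h [::] Q.
Proof. by do 3 eexists; split; [constructor|]. Qed.

Lemma evs_cons env h e es Q :
  ev env h e (fun h1 v n1 => evs env h1 es (fun h2 vs n2 =>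
    Q h2 (v :: vs) (n1 + n2))) ->
  evs env h (e :: es) Q.
Proof.
move=> [h1 [v1 [n1 [E1 [h2 [v2 [n2 [E2 q]]]]]]]].
by do 3 eexists; split; [econstructor; [exact: E1|exact: E2]|].
Qed.

Lemma nat_of_bool_neq0 (b : bool) : ((b : nat) != 0) = b.
Proof. by case: b. Qed.

Lemma eqn00 : (0 != 0) = false.
Proof. by []. Qed.

Lemma cell_spec env h x k (Q : heap -> nat -> nat -> Prop) :
  Q h (mem h (nth 0 env x + k)) 4 -> ev env h (cell x k) Q.
Proof. by move=> q; apply/ev_Read/ev_Bin/ev_Var/ev_Const. Qed.

Lemma length_of_spec env h x t (Q : heap -> nat -> nat -> Prop) :
  tree_at h (nth 0 env x) t ->
  (forall n, n <= 6 -> Q h (total_length t) n) -> ev env h (length_of x) Q.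
Proof.
case: t => [|l y r] H q; apply/ev_If/ev_Var.
  by rewrite H; apply/ev_Const/q.
case: H q => [[p0 _] _ _ _ [<- _]] q.
by rewrite -lt0n p0; apply/cell_spec/q.
Qed.

Lemma height_of_spec env h x t (Q : heap -> nat -> nat -> Prop) :
  tree_at h (nth 0 env x) t ->
  (forall n, n <= 6 -> Q h (height t) n) -> ev env h (height_of x) Q.
Proof.
case: t => [|l y r] H q; apply/ev_If/ev_Var.
  by rewrite H; apply/ev_Const/q.
case: H q => [[p0 _] _ _ _ [_ <-]] q.
by rewrite -lt0n p0; apply/cell_spec/q.
Qed.

End Execution.
Opaque update_program.

Ltac ev_simpl :=
  cbn beta iota delta [nth set_register do_binop];
  rewrite ?nat_of_bool_neq0 ?eqn00; cbn iota.

Ltac ev_step :=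
  lazymatch goal with
  | |- ev _ _ _ _ (Var _) _ => apply: ev_Var
  | |- ev _ _ _ _ (Const _) _ => apply: ev_Const
  | |- ev _ _ _ _ (Bin _ _ _) _ => apply: ev_Bin
  | |- ev _ _ _ _ (Half _) _ => apply: ev_Half
  | |- ev _ _ _ _ (Let _ _ _) _ => apply: ev_Let
  | |- ev _ _ _ _ (If _ _ _) _ => apply: ev_If
  | |- ev _ _ _ _ (Call _ _) _ => apply: ev_Call
  | |- ev _ _ _ _ (Read _) _ => apply: ev_Read
  | |- ev _ _ _ _ (Write _ _) _ => apply: ev_Write
  | |- ev _ _ _ _ (Alloc _) _ => apply: ev_Alloc
  | |- ev _ _ _ _ TextSize _ => apply: ev_TextSize
  | |- ev _ _ _ _ (TextChar _) _ => apply: ev_TextChar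
  | |- ev _ _ _ _ (TextSA _) _ => apply: ev_TextSA
  | |- ev _ _ _ _ (TextISA _) _ => apply: ev_TextISA
  | |- ev _ _ _ _ (TextLCP _) _ => apply: ev_TextLCP
  | |- ev _ _ _ _ (TextRMQ _ _) _ => apply: ev_TextRMQ
  | |- ev _ _ _ _ (cell _ _) _ => apply: cell_spec
  | |- evs _ _ _ _ [::] _ => apply: evs_nil
  | |- evs _ _ _ _ (_ :: _) _ => apply: evs_cons
  end; ev_simpl.

Ltac ev_run := ev_simpl; repeat ev_step.

(** * Tree procedures *)

Section Procedures.
Variables (T : str) (rmq : nat -> nat -> nat).
Local Notation prog := update_program.
Local Notation proc f := (nth (Const 0) prog f).
Local Notation ev := (ev T rmq).

Lemma mk_spec h l r a b c tl tr (Q : heap -> nat -> nat -> Prop) :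
  tree_at h l tl -> tree_at h r tr ->
  (forall h' v n, hext h h' -> tree_at h' v (Node tl (a, (b, c)) tr) ->
    n <= 100 -> Q h' v n) ->
  ev [:: l; r; a; b; c] h (proc p_mk) Q.
Proof.
move=> Hl Hr q; change (proc p_mk) with mk_body; rewrite /mk_body.
ev_run; apply: (@length_of_spec _ _ _ _ _ tl) => // n1 hn1.
ev_run; apply: (@length_of_spec _ _ _ _ _ tr) => // n2 hn2.
ev_run; apply: (@height_of_spec _ _ _ _ _ tl) => // n3 hn3.
ev_run; apply: (@height_of_spec _ _ _ _ _ tr) => // n4 hn4.
ev_run.
(* Moving the conditional into the register index keeps the rest of the execution in one branch. *)
set m := (X in ev _ _ X); have -> : m = Var (if height tl < height tr then 7 else 6).
  by rewrite /m; case: ifP.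
ev_run.
set w := nth _ _ _; have {w}-> : w = maxn (height tl) (height tr).
  by rewrite /w; case: ltnP => hlt /=; lia.
move: m => _.
set p := (brk h).+1.
set h' := update _ _ _.
(* All written addresses lie above [brk h], so an old address falls through every update. *)
have ext : hext h h'.
  split=> [|x lex]; rewrite /h' /=; first by rewrite leq_addr.
  by repeat (case: eqP; first by rewrite /p; lia); move=> *.
apply: q => //; last by lia.
split; try by rewrite /h' /p /=; lia.
- rewrite (_ : mem h' p = l); first exact: tree_at_ext Hl.
  by rewrite /h' /=; repeat (case: eqP; first by lia); move=> *; rewrite // eqxx.
- rewrite (_ : mem h' (p + 1) = r); first exact: tree_at_ext Hr.
  rewrite /h' /=; repeat (case: eqP; try by lia).
- by split; rewrite /h' /=; repeat (case: eqP; try by lia).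
- rewrite total_length_node; split; rewrite /h' /=; repeat (case: eqP; try by lia).
Qed.

Lemma balance_spec h l r a b c tl tr (Q : heap -> nat -> nat -> Prop) :
  tree_at h l tl -> tree_at h r tr ->
  (forall h' v n, hext h h' -> tree_at h' v (tbalance tl (a, (b, c)) tr) ->
    n <= 500 -> Q h' v n) ->
  ev [:: l; r; a; b; c] h (proc p_balance) Q.
Proof.
move=> Hl Hr q; change (proc p_balance) with balance_body; rewrite /balance_body.
ev_run; apply: (@height_of_spec _ _ _ _ _ tl) => // n1 hn1.
ev_run; apply: (@height_of_spec _ _ _ _ _ tr) => // n2 hn2.
ev_run; move: q; rewrite /tbalance addn1; case: ifP => c1 q.
  case: tl Hl q c1 => [|tll [a1 [b1 c1']] tlr] //.
  move=> /tree_at_node[[p0 pb] Hll Hlr [e2 e3 e4] _] q c1.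
  ev_run; apply: (@height_of_spec _ _ _ _ _ tll) => // n3 hn3.
  ev_run; apply: (@height_of_spec _ _ _ _ _ tlr) => // n4 hn4.
  ev_run; move: q; rewrite e2 e3 e4; case: ifP => c2 q.
    case: tlr Hlr q c1 c2 => [|t1 [a2 [b2 c2']] t2] //.
    move=> /tree_at_node[[p0' pb'] H1 H2 [e2' e3' e4'] _] q c1 c2.
    ev_run; rewrite e2' e3' e4'.
    apply: (mk_spec Hll H1) => h1 v1 k1 x1 t1' hk1.
    ev_run.
    apply: (mk_spec (tree_at_ext x1 H2) (tree_at_ext x1 Hr)) => h2 v2 k2 x2 t2' hk2.
    ev_run; apply: (mk_spec (tree_at_ext x2 t1') t2') => h3 v3 k3 x3 t3' hk3.
    by apply: q => //; [exact: hext_trans (hext_trans x1 x2) x3|lia].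
  ev_run; apply: (mk_spec Hlr Hr) => h1 v1 k1 x1 t1' hk1.
  ev_run; apply: (mk_spec (tree_at_ext x1 Hll) t1') => h2 v2 k2 x2 t2' hk2.
  by apply: q => //; [exact: hext_trans x1 x2|lia].
ev_run; move: q; rewrite addn1; case: ifP => c2 q.
  case: tr Hr q c1 c2 => [|trl [a1 [b1 c1']] trr] //.
  move=> /tree_at_node[[p0 pb] Hrl Hrr [e2 e3 e4] _] q c1 c2.
  ev_run; apply: (@height_of_spec _ _ _ _ _ trl) => // n3 hn3.
  ev_run; apply: (@height_of_spec _ _ _ _ _ trr) => // n4 hn4.
  ev_run; move: q; rewrite e2 e3 e4; case: ifP => c3 q.
    case: trl Hrl q c1 c2 c3 => [|t1 [a2 [b2 c2']] t2] //.
    move=> /tree_at_node[[p0' pb'] H1 H2 [e2' e3' e4'] _] q c1 c2 c3.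
    ev_run; rewrite e2' e3' e4'.
    apply: (mk_spec Hl H1) => h1 v1 k1 x1 t1' hk1.
    ev_run.
    apply: (mk_spec (tree_at_ext x1 H2) (tree_at_ext x1 Hrr)) => h2 v2 k2 x2 t2' hk2.
    ev_run; apply: (mk_spec (tree_at_ext x2 t1') t2') => h3 v3 k3 x3 t3' hk3.
    by apply: q => //; [exact: hext_trans (hext_trans x1 x2) x3|lia].
  ev_run; apply: (mk_spec Hl Hrl) => h1 v1 k1 x1 t1' hk1.
  ev_run; apply: (mk_spec t1' (tree_at_ext x1 Hrr)) => h2 v2 k2 x2 t2' hk2.
  by apply: q => //; [exact: hext_trans x1 x2|lia].
ev_run; apply: (mk_spec Hl Hr) => h1 v1 k1 x1 t1' hk1.
by apply: q => //; lia.
Qed.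

Lemma insert_spec t h p pos a b c (Q : heap -> nat -> nat -> Prop) :
  tree_at h p t ->
  (forall h' v n, hext h h' -> tree_at h' v (tinsert t pos (a, (b, c))) ->
    n <= 1000 * (height t).+1 -> Q h' v n) ->
  ev [:: p; pos; a; b; c] h (proc p_insert) Q.
Proof.
elim: t h p pos Q => [|l IHl [a1 [b1 c1]] r IHr] h p pos Q.
  move=> -> q; change (proc p_insert) with insert_body; rewrite /insert_body.
  ev_run; apply: (@mk_spec h 0 0 a b c Leaf Leaf) => // h1 v1 k1 x1 t1 hk1.
  by apply: q => //=; lia.
case/tree_at_node=> [[p0 pb] Hl Hr [e2 e3 e4] _] q.
change (proc p_insert) with insert_body; rewrite /insert_body.
ev_run; rewrite -lt0n p0.
ev_run; rewrite e2 e3 e4; apply: (@length_of_spec _ _ _ _ _ l) => // n1 hn1.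
ev_run; move: q; rewrite [tinsert _ _ _]/=; case: ifP => c2 q.
  ev_run; apply: IHr Hr _ => h1 v1 k1 x1 t1 hk1.
  ev_run; apply: (balance_spec (tree_at_ext x1 Hl) t1) => h2 v2 k2 x2 t2 hk2.
  by apply: q; [exact: hext_trans x2| |simpl; lia].
ev_run; apply: IHl Hl _ => h1 v1 k1 x1 t1 hk1.
ev_run; apply: (balance_spec t1 (tree_at_ext x1 Hr)) => h2 v2 k2 x2 t2 hk2.
by apply: q; [exact: hext_trans x2| |simpl; lia].
Qed.

(** What is kept of an address returned by a descent: the piece alone, without the subtrees. The
    bound by [brk] makes it stable under heap extension. *)
Definition node_at (h : heap) (p : nat) (x : piece) : Prop :=
  p + 6 <= brk h /\
  [/\ mem h (p + 2) = x.1, mem h (p + 3) = x.2.1 & mem h (p + 4) = x.2.2].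

Lemma node_at_ext h h' p x : hext h h' -> node_at h p x -> node_at h' p x.
Proof.
move=> [le eq] [pb [e2 e3 e4]]; split; first exact: leq_trans le.
by rewrite !eq //; lia.
Qed.

Lemma min_spec t h p (Q : heap -> nat -> nat -> Prop) :
  tree_at h p t -> t <> Leaf ->
  (forall v n, node_at h v (tmin t) -> n <= 50 * height t -> Q h v n) ->
  ev [:: p] h (proc p_min) Q.
Proof.
elim: t p Q => [|l IHl x r _] p Q // /tree_at_node[[p0 pb] Hl Hr e _] _ q.
change (proc p_min) with min_body; rewrite /min_body.
ev_run; case: l IHl Hl q => [|ll lx lr] IHl Hl q.
  by rewrite Hl; ev_run; apply: q; [|simpl; lia].
case/tree_at_node: (Hl) => [[p0' _] _ _ _ _]; rewrite -lt0n p0'.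
ev_run; apply: IHl Hl _ _ => // v n Hv hn.
by apply: q => //; simpl in *; lia.
Qed.

Lemma delete_min_spec t h p (Q : heap -> nat -> nat -> Prop) :
  tree_at h p t -> t <> Leaf ->
  (forall h' v n, hext h h' -> tree_at h' v (tdelete_min t) ->
    n <= 1000 * height t -> Q h' v n) ->
  ev [:: p] h (proc p_delete_min) Q.
Proof.
elim: t h p Q => [|l IHl [a [b c]] r _] h p Q //.
move=> /tree_at_node[[p0 pb] Hl Hr [e2 e3 e4] _] _ q.
change (proc p_delete_min) with delete_min_body; rewrite /delete_min_body.
ev_run; case: l IHl Hl q => [|ll lx lr] IHl Hl q.
  by rewrite Hl; ev_run; apply: q => //; simpl; lia.
case/tree_at_node: (Hl) => [[p0' _] _ _ _ _]; rewrite -lt0n p0'.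
ev_run; rewrite e2 e3 e4; apply: IHl Hl _ _ => // h1 v1 k1 x1 t1 hk1.
ev_run; apply: (balance_spec t1 (tree_at_ext x1 Hr)) => h2 v2 k2 x2 t2 hk2.
apply: q; [exact: hext_trans x2|exact: t2|simpl in *; lia].
Qed.

Lemma delete_spec t h p pos (Q : heap -> nat -> nat -> Prop) :
  tree_at h p t ->
  (forall h' v n, hext h h' -> tree_at h' v (tdelete t pos) ->
    n <= 3000 * (height t).+1 -> Q h' v n) ->
  ev [:: p; pos] h (proc p_delete) Q.
Proof.
elim: t h p pos Q => [|l IHl [a [b c]] r IHr] h p pos Q.
  move=> -> q; change (proc p_delete) with delete_body; rewrite /delete_body.
  by ev_run; apply: q.
case/tree_at_node=> [[p0 pb] Hl Hr [e2 e3 e4] _] q.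
change (proc p_delete) with delete_body; rewrite /delete_body.
ev_run; rewrite -lt0n p0.
ev_run; rewrite e2 e3 e4; apply: (@length_of_spec _ _ _ _ _ l) => // n1 hn1.
ev_run; move: q; rewrite [tdelete _ _]/=; case: ifP => c2 q.
  ev_run; apply: IHl Hl _ => h1 v1 k1 x1 t1 hk1.
  ev_run; apply: (balance_spec t1 (tree_at_ext x1 Hr)) => h2 v2 k2 x2 t2 hk2.
  by apply: q; [exact: hext_trans x2| |simpl; lia].
ev_run; move: q; case: ifP => c3 q; last first.
  ev_run; apply: IHr Hr _ => h1 v1 k1 x1 t1 hk1.
  ev_run; apply: (balance_spec (tree_at_ext x1 Hl) t1) => h2 v2 k2 x2 t2 hk2.
  by apply: q; [exact: hext_trans x2| |simpl; lia].
case: r IHr Hr q => [|rl rx rr] IHr Hr q.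
  by ev_run; rewrite Hr; ev_run; apply: q => //; simpl; lia.
ev_run; case/tree_at_node: (Hr) => [[p0' _] _ _ _ _]; rewrite -lt0n p0'.
ev_run; apply: (min_spec Hr) => // v n [_ [m2 m3 m4]] hn.
ev_run; rewrite m2 m3 m4; apply: (delete_min_spec Hr) => // h1 v1 k1 x1 t1 hk1.
ev_run; apply: (balance_spec (tree_at_ext x1 Hl) t1) => h2 v2 k2 x2 t2 hk2.
apply: q; [exact: hext_trans x2| |simpl in *; lia].
by move: t2; rewrite -[(_, (_, _))]/(_, _) /tmerge; case: (tmin _) => ? [? ?].
Qed.

Lemma find_node_spec t h p pos (Q : heap -> nat -> nat -> Prop) :
  tree_at h p t -> pos < total_length t ->
  (forall v n, node_at h v (pfind (inorder t) pos) -> n <= 100 * (height t).+1 ->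
    Q h v n) ->
  ev [:: p; pos] h (proc p_find) Q.
Proof.
elim: t p pos Q => [|l IHl x r IHr] p pos Q // /tree_at_node[[p0 pb] Hl Hr e _].
rewrite total_length_node => hpos q.
change (proc p_find) with find_body; rewrite /find_body.
ev_run; apply: (@length_of_spec _ _ _ _ _ l) => // n1 hn1.
ev_run; move: q; rewrite /= pfind_cat -total_lengthE; case: ifP => c2 q.
  ev_run; apply: IHl Hl _ _ => // v n Hv hn.
  by apply: q => //; lia.
case: (e) => -> _ _; move: q; rewrite /= ltn_subLR; last by lia.
move=> q; ev_run; move: q; case: ifP => c3 q.
  by ev_run; apply: q; [|lia].
ev_run; apply: IHr Hr _ _ => [|v n Hv hn]; first by lia.
by apply: q; [rewrite -subnDA|lia].
Qed.

Lemma offset_spec t h p pos (Q : heap -> nat -> nat -> Prop) :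
  tree_at h p t -> pos < total_length t ->
  (forall n, n <= 100 * (height t).+1 -> Q h (poffset (inorder t) pos) n) ->
  ev [:: p; pos] h (proc p_offset) Q.
Proof.
elim: t p pos Q => [|l IHl x r IHr] p pos Q // /tree_at_node[[p0 pb] Hl Hr e _].
rewrite total_length_node => hpos q.
change (proc p_offset) with offset_body; rewrite /offset_body.
ev_run; apply: (@length_of_spec _ _ _ _ _ l) => // n1 hn1.
ev_run; move: q; rewrite /= poffset_cat -total_lengthE; case: ifP => c2 q.
  ev_run; apply: IHl Hl _ _ => // n hn.
  by apply: q => //; lia.
case: (e) => -> _ _; move: q; rewrite /= ltn_subLR; last by lia.
move=> q; ev_run; move: q; case: ifP => c3 q.
  by ev_run; apply: q; lia.
ev_run; apply: IHr Hr _ _ => [|n hn]; first by lia.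
by rewrite subnDA; apply: q; lia.
Qed.

End Procedures.

(** * Occurrence partitions and searches *)

Section Partitions.

Variable T : str.

Definition piece_ok (Q : str) : bool :=
  (Q != [::]) && (infix Q T || (size Q == 1) && (head 0 Q \notin T)).

Definition unmergeable : rel str := fun X Y => ~~ infix (X ++ Y) T.

Lemma occurrence_partitionP P ps :
  occurrence_partition P T ps <->
  [/\ flatten ps = P, all piece_ok ps & sorted unmergeable ps].
Proof.
split=> [[fl ne ok adj]|[fl /allP ok /(sortedP [::]) adj]].
  split=> //; last exact/(sortedP [::]).
  apply/allP=> Q Qps; rewrite /piece_ok; apply/andP; split; first exact/eqP/ne.
  by case: (ok Q Qps) => [->|[a -> /= ->]]; rewrite ?orbT.
split=> // Q /ok /andP[/eqP Q0 h] //.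
case/orP: h => [|/andP[]]; first by left.
by case: Q Q0 => [|a [|b Q]] //= _ _ h; right; exists a.
Qed.

(* A list of pieces is traversed from left to right as a zipper: the pieces
   [z] to the left of the focus are in reverse order. *)
Definition text (z : seq str) : str := flatten (rev z).

Definition spush (z : seq str) (X : str) : seq str :=
  if z is Y :: z' then if infix (Y ++ X) T then (Y ++ X) :: z' else X :: z
  else [:: X].

Definition good (z : seq str) : bool :=
  all piece_ok z && sorted (fun X Y => unmergeable Y X) z.

Lemma goodE z : good z = all piece_ok (rev z) && sorted unmergeable (rev z).
Proof. by rewrite /good all_rev rev_sorted. Qed.

Lemma text_cons X z : text (X :: z) = text z ++ X.
Proof. by rewrite /text rev_cons flatten_rcons. Qed.

Lemma text_spush z X : text (spush z X) = text z ++ X.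
Proof.
case: z => [|Y z]; first by rewrite /= text_cons.
by rewrite /spush; case: ifP => _; rewrite !text_cons // catA.
Qed.

Lemma piece_ok_cat X Y : piece_ok X -> infix (X ++ Y) T -> piece_ok (X ++ Y).
Proof. by rewrite /piece_ok => /andP[X0 _] ->; case: X X0. Qed.

(** One merge attempt is enough: if [Y] absorbs [X], the piece [Z] before [Y] cannot be merged in
    turn, as [Z ++ Y ++ X] contains [Z ++ Y]. *)
Lemma good_spush z X : good z -> piece_ok X -> good (spush z X).
Proof.
rewrite /good; case: z => [|Y z] /=; first by move=> _ ->.
case/andP=> /andP[okY okz] pz okX; case: ifP => hi /=.
  rewrite (piece_ok_cat okY hi) okz /=.
  case: z pz {okz} => //= Z z /andP[h ->]; rewrite andbT.
  by apply: contra h; rewrite catA => /catr_infix.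
by rewrite okX okY okz /= pz /unmergeable hi.
Qed.

Definition spush_nonempty (z : seq str) (X : str) : seq str :=
  if X is [::] then z else spush z X.

Lemma text_spush_nonempty z X : text (spush_nonempty z X) = text z ++ X.
Proof. by case: X => [|a X]; rewrite /= ?cats0 // text_spush. Qed.

(** An absent piece has one character, so its only nonempty substring is itself; the second
    conclusion allows its empty range to be reused. *)
Lemma piece_ok_substring X o m : piece_ok X -> 0 < m -> o + m <= size X ->
  piece_ok (take m (drop o X)) /\ (~~ infix X T -> take m (drop o X) = X).
Proof.
case/andP=> X0 okX m0 le.
have sz : size (take m (drop o X)) = m by rewrite size_takel // size_drop; lia.
case: (boolP (infix X T)) okX => [iX _|niX /= /andP[/eqP sz1 hX]].
  split=> //; rewrite /piece_ok -size_eq0 sz -lt0n m0 /=.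
  rewrite (infix_trans _ iX) //; apply/infixP.
  by exists (take o X), (drop m (drop o X)); rewrite cat_take_drop cat_take_drop.
have [o0 m1] : o = 0 /\ m = size X by lia.
have -> : take m (drop o X) = X by rewrite o0 drop0 m1 take_size.
by split=> //; rewrite /piece_ok X0 sz1 hX orbT.
Qed.

Lemma good_spush_nonempty z X : good z -> (X <> [::] -> piece_ok X) ->
  good (spush_nonempty z X).
Proof. by case: X => //= a X gz okX; apply: good_spush => //; apply: okX. Qed.

(** Meant for the last push: there [X] is an original piece followed by its original successors, so
    its junction with [s] is known, while earlier pushes leave theirs open. *)
Lemma sorted_spush z X s : good z -> piece_ok X -> path unmergeable X s ->
  sorted unmergeable (catrev (spush z X) s).
Proof.
move=> gz okX pX; have /andP[_] := good_spush gz okX.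
have sorted_catrev W z' : sorted (fun X Y => unmergeable Y X) (W :: z') ->
    path unmergeable W s -> sorted unmergeable (catrev (W :: z') s).
  move=> h1 h2; rewrite catrevE rev_cons cat_rcons sorted_cat_cons h2 andbT.
  by rewrite -rev_cons rev_sorted.
rewrite /spush; case: z gz => [|Y z] gz; first by move=> h; apply: sorted_catrev.
case: ifP => _ h; apply: sorted_catrev => //.
case: s pX => //= Z s /andP[h1 ->]; rewrite andbT.
by apply: contra h1; rewrite -catA => /catl_infix.
Qed.

Lemma all_piece_ok_catrev z s :
  all piece_ok (catrev z s) = all piece_ok z && all piece_ok s.
Proof. by rewrite catrevE all_cat all_rev. Qed.

Definition entry (Q : str) : piece := (size Q, SR Q T).

Lemma lengths_entry ps : lengths (map entry ps) = size (flatten ps).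
Proof. by rewrite /lengths size_flatten -map_comp. Qed.

Lemma entry_gt0 ps : all piece_ok ps -> all (fun y : piece => 0 < y.1) (map entry ps).
Proof.
by move=> ok; rewrite all_map; apply: sub_all ok => Q /andP[]; case: Q.
Qed.

Lemma size_pieces (ps : seq str) : all piece_ok ps -> size ps <= size (flatten ps).
Proof.
elim: ps => //= Q ps IH /andP[/andP[Q0 _] /IH h]; rewrite size_cat.
by case: Q Q0 => //= a Q _; lia.
Qed.

Lemma size_text (z : seq str) : size (text z) = size (flatten z).
Proof.
by rewrite /text !size_flatten /shape map_rev sumn_rev.
Qed.

Lemma flatten_catrev (z s : seq str) : flatten (catrev z s) = text z ++ flatten s.
Proof. by rewrite catrevE flatten_cat. Qed.

Lemma locate_piece (ps : seq str) i : i < size (flatten ps) ->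
  exists (s1 : seq str) (X : str) (s2 : seq str) (o : nat),
    [/\ ps = s1 ++ X :: s2, i = size (flatten s1) + o & o < size X].
Proof.
elim: ps i => //= X ps IH i; rewrite size_cat => hi.
case: (ltnP i (size X)) => h; first by exists [::], X, ps, i.
have [|s1 [Y [s2 [o [-> eqi lto]]]]] := IH (i - size X); first by lia.
exists (X :: s1), Y, s2, o; split=> //=; rewrite size_cat; lia.
Qed.

End Partitions.

(* Execution times are measured in this unit, kept folded so that [lia]
   treats it as an atom. *)
Definition budget (T : str) : nat := 1000 * (trunc_log 2 (size T)).+1.

Lemma budget_ge T : 200 <= budget T.
Proof. by rewrite /budget; lia. Qed.

(** * Binary searches over ranks *)

Section Searches.

Variables (T : str) (rmq : nat -> nat -> nat).
Hypothesis rmqP : is_rmq (LCP T) rmq.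
Local Notation n := (size T).
Local Notation prog := update_program.
Local Notation proc f := (nth (Const 0) prog f).
Local Notation ev := (ev T rmq).
Local Notation sa := (nth 0 (SA T)).
Local Notation isa := (nth 0 (ISA T)).
Local Notation lg := (trunc_log 2 (size T)).+1.

(** Shared by the four searches, which differ in procedure index and test. The test is specified
    only strictly below [hi0], since at the end of the range it may be meaningless. *)
Lemma search_spec f test (p : nat -> bool) h x y lo0 hi0 :
  proc f = search_body f test ->
  (forall lo hi mid (Q : heap -> nat -> nat -> Prop), lo0 <= mid < hi0 ->
    (forall k, k <= 30 -> Q h (p mid) k) ->
    ev [:: lo; hi; x; y; mid] h test Q) ->
  (forall i j, lo0 <= i <= j -> j < hi0 -> p i -> p j) ->
  hi0 <= n -> lo0 <= hi0 ->
  forall Q : heap -> nat -> nat -> Prop,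
  (forall v k, lo0 <= v <= hi0 -> (forall i, lo0 <= i < v -> ~~ p i) ->
    (forall i, v <= i < hi0 -> p i) -> k <= budget T -> Q h v k) ->
  ev [:: lo0; hi0; x; y] h (proc f) Q.
Proof.
move=> procE testP mono hin lohi Q q.
(* At most [d] halvings remain; the indices already discarded are described relative to the fixed
   [lo0] and [hi0]. The factor 70 covers the 30 steps of a test and the overhead of a call. *)
have main d lo hi (Q' : heap -> nat -> nat -> Prop) :
  lo0 <= lo <= hi -> hi <= hi0 -> hi - lo < 2 ^ d ->
  (forall i, lo0 <= i < lo -> ~~ p i) -> (forall i, hi <= i < hi0 -> p i) ->
  (forall v k, lo0 <= v <= hi0 -> (forall i, lo0 <= i < v -> ~~ p i) ->
    (forall i, v <= i < hi0 -> p i) -> k <= 70 * d.+1 -> Q' h v k) ->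
  ev [:: lo; hi; x; y] h (proc f) Q'.
  elim: d lo hi Q' => [|d IH] lo hi Q' h1 h2 h3 h4 h5 q'.
    rewrite procE /search_body; ev_run; have -> : lo < hi = false by lia.
    ev_run; apply: q' => //; [lia|].
    by move=> i hi'; apply: h5; lia.
  rewrite procE /search_body; ev_run; case: ltnP => h6; last first.
    by ev_run; apply: q' => //; [lia| |lia] => i hi'; apply: h5; lia.
  ev_run; set mid := (lo + hi)./2; have hm : lo <= mid < hi by rewrite /mid; lia.
  have hm2 : (lo + hi)./2 = mid by [].
  rewrite expnS in h3.
  apply: testP => [|k hk]; first by lia.
  rewrite nat_of_bool_neq0; case: ifP => pm.
    ev_run; apply: IH; try lia; try by [].
      by move=> i hi'; apply: (mono mid) => //; lia.
    by move=> v k' h7 h8 h9 h10; apply: q' => //; lia.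
  ev_run; rewrite addn1; apply: IH; try lia; try by [].
    move=> i hi'; apply/negP => pi; move/negP: pm; apply.
    by apply: (mono i) => //; lia.
  by move=> v k' h7 h8 h9 h10; apply: q' => //; lia.
have ltn := trunc_log_ltn n (ltnSn 1).
apply: (main lg) => //; try lia.
by move=> v k h7 h8 h9 h10; apply: q => //; rewrite /budget; lia.
Qed.

Lemma range_left_spec env h x y q m (Q : heap -> nat -> nat -> Prop) :
  nth 0 env x = q -> nth 0 env y = m -> 0 < m -> q + m <= n ->
  (forall k, k <= 2 * budget T -> Q h (SR (take m (drop q T)) T).1 k) ->
  ev env h (range_left x y) Q.
Proof.
move=> eqx eqy m0 leqm; have := SR_substring rmqP m0 leqm.
case: SR => l r /= [h1 h1n h2 _] HQ.
rewrite /range_left; ev_run; rewrite eqx eqy.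
apply: (@search_spec p_search_left left_test
  (fun i => m <= nth 0 (LCP T) (rmq i (isa q)))) => //.
- move=> lo hi mid Q' hmid hQ; rewrite /left_test; ev_run.
  by rewrite addn1 ltnS; apply: hQ.
- by move=> i j hij ltj; rewrite !h2 //; lia.
- by lia.
move=> v k hv h3 h4 hk.
have -> : v = l; last by apply: HQ; have := budget_ge T; lia.
(* If the search returns [isa q], nothing has been tested there, and [l <= v] holds because [isa q]
   lies in the range. *)
have A : v < isa q -> l <= v by move=> hv'; rewrite -h2 // h4 //; lia.
have B : l < v -> false.
  by move=> hv'; have := h3 l; rewrite h2 ?leqnn; [apply; lia|lia].
by case: (ltngtP v l) => [hvl|/B|] //; have := A; lia.
Qed.

Lemma range_right_spec env h x y q m (Q : heap -> nat -> nat -> Prop) :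
  nth 0 env x = q -> nth 0 env y = m -> 0 < m -> q + m <= n ->
  (forall k, k <= 2 * budget T -> Q h (SR (take m (drop q T)) T).2 k) ->
  ev env h (range_right x y) Q.
Proof.
move=> eqx eqy m0 leqm; have := SR_substring rmqP m0 leqm.
case: SR => l r /= [h1 h1n _ h2] HQ.
rewrite /range_right; ev_run; rewrite eqx eqy addn1.
apply: (@search_spec p_search_right right_test
  (fun i => nth 0 (LCP T) (rmq (isa q) i) < m)) => //.
- move=> lo hi mid Q' hmid hQ; rewrite /right_test; ev_run; exact: hQ.
- by move=> i j hij ltj; rewrite !ltnNge !h2 //; lia.
- by lia.
move=> v k hv h3 h4 hk.
have -> : v = r; last by apply: HQ; have := budget_ge T; lia.
have A : v < n -> r <= v.
  by move=> hv'; have := h4 v ltac:(lia); rewrite ltnNge h2; lia.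
have B : r < v -> false.
  by move=> hv'; have := h3 r ltac:(lia); rewrite -leqNgt h2; lia.
by case: (ltngtP v r) => [hvl|/B|] //; have := A; lia.
Qed.

Lemma rank_of_spec env h x (Q : heap -> nat -> nat -> Prop) :
  (forall k, k <= 10 -> Q h (rank T (nth 0 env x)) k) -> ev env h (rank_of x) Q.
Proof.
move=> HQ; rewrite /rank_of; ev_run; move: HQ; rewrite /rank; case: ifP => _ HQ.
  by ev_run; rewrite addn1; apply: HQ.
by ev_run; apply: HQ.
Qed.

End Searches.

(** * The update *)

Section Update.

Variables (T : str) (rmq : nat -> nat -> nat).
Hypothesis rmqP : is_rmq (LCP T) rmq.
Hypothesis T0 : 0 < size T.
Local Notation n := (size T).
Local Notation prog := update_program.
Local Notation proc f := (nth (Const 0) prog f).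
Local Notation ev := (ev T rmq).
Local Notation sa := (nth 0 (SA T)).
Local Notation lg := (trunc_log 2 (size T)).+1.
Local Notation ok := (piece_ok T).

Definition stored (h : heap) (p : nat) (ps : seq str) : Prop :=
  exists t, [/\ tree_at h p t, inorder t = map (entry T) ps & balanced t].

(** Nonempty pieces bound the number of nodes by the text length. The 5 absorbs the additive terms
    of twice the logarithm plus 5. *)
Lemma stored_height t ps : inorder t = map (entry T) ps -> balanced t ->
  all ok ps -> size (flatten ps) <= n -> (height t).+1 <= 5 * lg.
Proof.
move=> it bt okps lesz.
have := @balanced_height t n T0 bt; rewrite it size_map.
have := size_pieces okps; lia.
Qed.

Lemma stored_length_of env h x ps (Q : heap -> nat -> nat -> Prop) :
  stored h (nth 0 env x) ps ->
  (forall k, k <= 6 -> Q h (size (flatten ps)) k) -> ev env h (length_of x) Q.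
Proof.
move=> [t [Ht it _]] HQ; apply: (@length_of_spec _ _ _ _ _ t _ Ht) => k hk.
by rewrite total_lengthE it lengths_entry; apply: HQ.
Qed.

Lemma stored_find h p pos s1 X s2 o (Q : heap -> nat -> nat -> Prop) :
  stored h p (s1 ++ X :: s2) -> all ok (s1 ++ X :: s2) ->
  size (flatten (s1 ++ X :: s2)) <= n ->
  pos = size (flatten s1) + o -> o < size X ->
  (forall v k, node_at h v (entry T X) -> k <= budget T -> Q h v k) ->
  ev [:: p; pos] h (proc p_find) Q.
Proof.
move=> [t [Ht it bt]] okps lesz -> lto HQ.
have hh := stored_height it bt okps lesz.
apply: (find_node_spec T rmq Ht) => [|v k Hv hk].
  by rewrite total_lengthE it lengths_entry flatten_cat !size_cat /= ?size_cat; lia.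
apply: HQ; last by rewrite /budget; lia.
by move: Hv; rewrite it map_cat -(lengths_entry T) pfind_mid.
Qed.

Lemma stored_offset h p pos s1 X s2 o (Q : heap -> nat -> nat -> Prop) :
  stored h p (s1 ++ X :: s2) -> all ok (s1 ++ X :: s2) ->
  size (flatten (s1 ++ X :: s2)) <= n ->
  pos = size (flatten s1) + o -> o < size X ->
  (forall k, k <= budget T -> Q h o k) ->
  ev [:: p; pos] h (proc p_offset) Q.
Proof.
move=> [t [Ht it bt]] okps lesz -> lto HQ.
have hh := stored_height it bt okps lesz.
apply: (offset_spec T rmq Ht) => [|k hk].
  by rewrite total_lengthE it lengths_entry flatten_cat !size_cat /= ?size_cat; lia.
by rewrite it map_cat -(lengths_entry T) poffset_mid //; apply: HQ; rewrite /budget; lia.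
Qed.

Lemma stored_delete h p pos s1 X s2 o (Q : heap -> nat -> nat -> Prop) :
  stored h p (s1 ++ X :: s2) -> all ok (s1 ++ X :: s2) ->
  size (flatten (s1 ++ X :: s2)) <= n ->
  pos = size (flatten s1) + o -> o < size X ->
  (forall h' v k, hext h h' -> stored h' v (s1 ++ s2) -> k <= 15 * budget T ->
    Q h' v k) ->
  ev [:: p; pos] h (proc p_delete) Q.
Proof.
move=> [t [Ht it bt]] okps lesz -> lto HQ.
have hh := stored_height it bt okps lesz.
apply: (delete_spec T rmq Ht) => h' v k x Hv hk.
apply: HQ => //; last by rewrite /budget; lia.
eexists; split; [exact: Hv| |by case: (balanced_tdelete (size (flatten s1) + o) bt)].
by rewrite inorder_tdelete it !map_cat -(lengths_entry T) pdelete_mid.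
Qed.

Lemma stored_insert h p pos s1 X s2 len l r (Q : heap -> nat -> nat -> Prop) :
  stored h p (s1 ++ s2) -> all ok (s1 ++ s2) ->
  size (flatten (s1 ++ s2)) <= n ->
  pos = size (flatten s1) -> entry T X = (len, (l, r)) ->
  (forall h' v k, hext h h' -> stored h' v (s1 ++ X :: s2) -> k <= 5 * budget T ->
    Q h' v k) ->
  ev [:: p; pos; len; l; r] h (proc p_insert) Q.
Proof.
move=> [t [Ht it bt]] okps lesz -> eX HQ.
have hh := stored_height it bt okps lesz.
apply: (insert_spec T rmq Ht) => h' v k x Hv hk.
apply: HQ => //; last by rewrite /budget; lia.
rewrite -eX in Hv.
eexists; split; [exact: Hv| |
  by case: (balanced_tinsert (size (flatten s1)) (entry T X) bt)].
rewrite inorder_tinsert it !map_cat -(lengths_entry T) pinsert_mid //.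
by apply: (@entry_gt0 T); move: okps; rewrite all_cat => /andP[].
Qed.

Lemma piece_ok_neq0 X : ok X -> X <> [::].
Proof. by case/andP=> /eqP. Qed.

(** Condition (2) is not assumed: between two pushes the junction of [z] and [s] may be mergeable.
    The 28 covers a descent and a search (1 each), a deletion (15), two range endpoints (2 each), an
    insertion (5) and overhead. *)
Lemma push_spec h p pos z s X len l r (Q : heap -> nat -> nat -> Prop) :
  stored h p (catrev z s) -> all ok (catrev z s) -> ok X ->
  size (text z) + size X + size (flatten s) <= n ->
  pos = size (text z) -> entry T X = (len, (l, r)) ->
  (forall h' v k, hext h h' -> stored h' v (catrev (spush T z X) s) ->
    k <= 28 * budget T -> Q h' v k) ->
  ev [:: p; pos; len; l; r] h (proc p_push) Q.
Proof.
have bge := budget_ge T.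
move=> Hp okps okX lesz posE eX HQ.
have lesz' : size (flatten (catrev z s)) <= n by rewrite flatten_catrev size_cat; lia.
change (proc p_push) with push_body; rewrite /push_body.
case: z posE Hp okps lesz lesz' HQ => [|Y z] posE Hp okps lesz lesz' HQ.
  ev_run; rewrite posE [text _]/=; ev_run.
  apply: (@stored_insert h p 0 [::] X s) => // h1 v1 k1 x1 H1 hk1.
  by apply: HQ => //; lia.
have okY : ok Y by move: okps; rewrite all_piece_ok_catrev /= => /andP[/andP[]].
have Y0 := piece_ok_neq0 okY; have X0 := piece_ok_neq0 okX.
have szY : 0 < size Y by case: (Y) Y0.
rewrite text_cons size_cat size_text in posE.
have eqps : catrev (Y :: z) s = rev z ++ Y :: s by rewrite catrevE rev_cons cat_rcons.
(* The position before [X] is that of the last character of [Y]. *)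
have pos1 : pos - 1 = size (flatten (rev z)) + (size Y).-1.
  by rewrite -/(text z) size_text; lia.
have szY1 : (size Y).-1 < size Y by lia.
rewrite eqps in Hp okps lesz'.
case: eX => lenE rangeE.
ev_run; have -> : pos != 0 by lia.
ev_run; apply: (stored_find Hp okps lesz' pos1 szY1) => v1 k1 [_ [m2 m3 m4]] hk1.
ev_run; rewrite m2 m3 m4 [(entry T Y).1]/= [(entry T Y).2]/=.
have leSR : (SR Y T).1 <= (SR Y T).2.
  case: (boolP (infix Y T)) => iY; last by rewrite SR_not_infix.
  by have := SR_infix Y0 iY; case: SR => a b /= [/andP[/ltnW]].
apply: (@search_spec T rmq p_search_cat cat_test
  (fun i => l < rank T (sa i + size Y))) => //.
- move=> lo hi mid Q' hmid hQ; rewrite /cat_test; ev_run.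
  apply: rank_of_spec => k hk; ev_simpl; apply: hQ; lia.
- move=> i j hij ltj h1; apply: leq_trans h1 _.
  exact: rank_shift_mono.
- exact: SR_le.
move=> k0 t0 hk0 lo hi ht0.
have lE : l = (SR X T).1 by rewrite rangeE.
have rE : r = (SR X T).2 by rewrite rangeE.
have [||infE occ] := infix_cat_search Y0 X0 hk0.
- by move=> i hi'; rewrite -lE leqNgt lo.
- by move=> i hi'; rewrite -lE hi.
(* The condition is evaluated as a whole, so that the two outcomes of its
   lazy conjunction are not treated separately. *)
ev_simpl; do 7 ev_step; apply: ev_If.
set cond := If _ _ _.
have condP (Q' : heap -> nat -> nat -> Prop) env' : 
  (forall k, k <= 30 -> Q' h (infix (Y ++ X) T) k) ->
  ev [:: p, pos, len, l, r, v1, size Y, (SR Y T).1, (SR Y T).2, k0, sa k0,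
         sa k0 + size Y & env'] h cond Q'.
  move=> q'; rewrite /cond; ev_run; move: q'; rewrite infE; case: ifP => c1 /= q'.
    ev_run; apply: rank_of_spec => k hk; ev_run; rewrite addn1 ltnS rE; apply: q'; lia.
  by ev_run; apply: q'.
apply: condP => k2 hk2; rewrite nat_of_bool_neq0.
move: HQ; rewrite /spush; case: ifP => inf HQ; last first.
  ev_run; rewrite -cat_rcons in Hp okps lesz'.
  apply: (stored_insert (X := X) Hp okps lesz') => [||h1 v2 k3 x1 H1 hk3].
  - by rewrite flatten_rcons size_cat -/(text z) size_text.
  - by rewrite -lenE -rangeE.
  apply: HQ => //; last by lia.
  by rewrite catrevE !rev_cons -!cats1 -!catA /= -cat1s catA cats1.
have {}occ := occ (eq_trans (esym infE) inf).
have YX0 : Y ++ X <> [::] by case: (Y) Y0.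
have leqm := occurs_at_size YX0 occ; rewrite size_cat in leqm.
have takeE : take (size Y + len) (drop (sa k0) T) = Y ++ X.
  by apply/eqP; rewrite -lenE -size_cat -prefixE.
ev_run; apply: (stored_delete Hp okps lesz' pos1 szY1) => h1 v2 k3 x1 H1 hk3.
ev_run; apply: (range_left_spec rmqP (erefl _) (erefl _));
  [by ev_simpl; lia|by ev_simpl; lia|] => k4 hk4.
ev_run; apply: (range_right_spec rmqP (erefl _) (erefl _));
  [by ev_simpl; lia|by ev_simpl; lia|] => k5 hk5.
ev_run; rewrite takeE.
have okzs : all ok (rev z ++ s).
  by move: okps; rewrite !all_cat /= => /andP[-> /andP[_ ->]].
apply: (stored_insert (X := Y ++ X) H1 okzs) => [|||h2 v3 k6 x2 H2 hk6].
- move: lesz'; rewrite !flatten_cat.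
  by rewrite -[flatten (Y :: s)]/(Y ++ flatten s) !size_cat; lia.
- by rewrite -/(text z) size_text; lia.
- by rewrite /entry size_cat lenE; case: SR.
apply: HQ; [exact: hext_trans x2| |lia].
by rewrite catrevE rev_cons cat_rcons.
Qed.

Lemma push_sub_spec h p pos z s nd X o m (Q : heap -> nat -> nat -> Prop) :
  stored h p (catrev z s) -> all ok (catrev z s) -> ok X ->
  node_at h nd (entry T X) -> o + m <= size X ->
  size (text z) + m + size (flatten s) <= n -> pos = size (text z) ->
  (forall h' v k, hext h h' ->
    stored h' v (catrev (spush_nonempty T z (take m (drop o X))) s) ->
    k <= 34 * budget T -> Q h' v k) ->
  ev [:: p; pos; nd; o; m] h (proc p_push_sub) Q.
Proof.
have bge := budget_ge T.
move=> Hp okps okX [_ [m2 m3 m4]] leom lesz posE HQ.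
change (proc p_push_sub) with push_sub_body; rewrite /push_sub_body.
case: (posnP m) lesz leom HQ => [->|m0] lesz leom HQ.
  by ev_run; apply: HQ; rewrite ?take0 //; lia.
ev_run; rewrite -lt0n m0; ev_run; rewrite m3 m4.
have [] := piece_ok_substring okX m0 leom.
have sz : size (take m (drop o X)) = m by rewrite size_takel // size_drop; lia.
have eqp : spush_nonempty T z (take m (drop o X)) = spush T z (take m (drop o X)).
  by case: take sz => // sz; rewrite -sz in m0.
rewrite eqp in HQ; move: sz HQ {eqp}; set Y := take _ _ => sz HQ okY YE.
have X0 := piece_ok_neq0 okX.
have := infix_SR T X0; case: (boolP (infix X T)) => iX eqSR; last first.
  have /eqP lr : (SR X T).1 == (SR X T).2 by rewrite -[_ == _]negbK -eqSR.
  rewrite [(entry T X).2]/= -lr eqxx; ev_run.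
  apply: (push_spec Hp okps okY) => [|//||h1 v1 k1 x1 H1 hk1]; first by rewrite sz.
    by rewrite /entry sz YE // SR_not_infix.
  by apply: HQ => //; lia.
rewrite [(entry T X).2]/= (negbTE (esym eqSR)); ev_run.
have := SR_infix X0 iX; have := SR_le T X0; move E: (SR X T) => [l r] /= len [lr occE].
(* The left end of the range gives an occurrence of [X], and [Y] occurs [o] positions further. *)
have occ : occurs_at X T (sa l) by rewrite occE; lia.
have leX := occurs_at_size X0 occ.
have YE' : take m (drop (sa l + o) T) = Y.
  case/prefixP: occ => s' eqs'.
  rewrite addnC -drop_drop eqs' /Y drop_cat; case: ltnP => ho; last by lia.
  by rewrite takel_cat // size_drop; lia.
apply: (range_left_spec rmqP (erefl _) (erefl _));
  [by ev_simpl; lia|by ev_simpl; lia|] => k4 hk4.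
ev_run; apply: (range_right_spec rmqP (erefl _) (erefl _));
  [by ev_simpl; lia|by ev_simpl; lia|] => k5 hk5.
ev_run; rewrite YE'.
apply: (push_spec Hp okps okY) => [|//||h1 v1 k1 x1 H1 hk1]; first by rewrite sz.
  by rewrite /entry sz; case: SR.
by apply: HQ => //; lia.
Qed.

Lemma piece_ok_char a : ok [:: a].
Proof.
rewrite /piece_ok /=; case: (boolP (a \in T)) => aT; rewrite ?orbT // orbF.
by case/splitPr: aT => s s'; apply/infixP; exists s, s'.
Qed.

Lemma push_char_spec h p pos z s a (Q : heap -> nat -> nat -> Prop) :
  stored h p (catrev z s) -> all ok (catrev z s) ->
  size (text z) + 1 + size (flatten s) <= n -> pos = size (text z) ->
  (forall h' v k, hext h h' -> stored h' v (catrev (spush T z [:: a]) s) ->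
    k <= 34 * budget T -> Q h' v k) ->
  ev [:: p; pos; a] h (proc p_push_char) Q.
Proof.
have bge := budget_ge T.
move=> Hp okps lesz posE HQ.
change (proc p_push_char) with push_char_body; rewrite /push_char_body.
ev_run; apply: (@search_spec T rmq p_search_char char_test
  (fun i => a <= nth 0 T (sa i))) => //.
- move=> lo hi mid Q' hmid hQ; rewrite /char_test; ev_run.
  by rewrite addn1 ltnS; apply: hQ.
- by move=> i j hij ltj h1; apply: leq_trans h1 _; apply: char_mono; lia.
move=> k0 t0 hk0 lo hi ht0.
have aT : (a \in T) = (k0 < n) && (nth 0 T (sa k0) == a).
  by apply: mem_search => // i hi'; rewrite ltnNge lo.
ev_simpl; do 5 ev_step; apply: ev_If; set cond := If _ _ _.
have condP (Q' : heap -> nat -> nat -> Prop) env' :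
  (forall k, k <= 30 -> Q' h (a \in T) k) ->
  ev [:: p, pos, a, k0, sa k0 & env'] h cond Q'.
  move=> q'; rewrite /cond; ev_run; move: q'; rewrite aT; case: ifP => c1 /= q'.
    by ev_run; apply: q'.
  by ev_run; apply: q'.
apply: condP => k2 hk2; rewrite nat_of_bool_neq0.
have okc := piece_ok_char a.
case: ifP => haT; last first.
  ev_run; apply: (push_spec Hp okps okc) => // [|h1 v1 k1 x1 H1 hk1].
    rewrite /entry SR_not_infix //; apply/negP => /infixP[s1 [s2 eqT]].
    by rewrite eqT mem_cat mem_head orbT in haT.
  by apply: HQ => //; lia.
move: (haT); rewrite aT => /andP[ltk0 /eqP eqa].
have lt0 := SA_lt ltk0.
have YE : take 1 (drop (sa k0) T) = [:: a] by rewrite (drop_nth 0 lt0) eqa /= take0.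
ev_run; apply: (range_left_spec rmqP (erefl _) (erefl _));
  [by ev_simpl; lia|by ev_simpl; lia|] => k4 hk4.
ev_run; apply: (range_right_spec rmqP (erefl _) (erefl _));
  [by ev_simpl; lia|by ev_simpl; lia|] => k5 hk5.
ev_run; rewrite YE.
apply: (push_spec Hp okps okc) => // [|h1 v1 k1 x1 H1 hk1].
  by rewrite /entry; case: SR.
by apply: HQ => //; lia.
Qed.

(** A single postcondition for both outcomes keeps the execution of the main procedure from
    splitting by kind of edit. *)
Lemma maybe_push_char_spec env h p pos z s (ins : bool) a
    (Q : heap -> nat -> nat -> Prop) :
  nth 0 env 8 = p -> nth 0 env 1 = pos -> nth 0 env 2 = ins -> nth 0 env 3 = a ->
  stored h p (catrev z s) -> all ok (catrev z s) ->
  size (text z) + ins + size (flatten s) <= n -> pos = size (text z) ->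
  (forall h' v k, hext h h' ->
    stored h' v (catrev (if ins then spush T z [:: a] else z) s) ->
    k <= 35 * budget T -> Q h' v k) ->
  ev env h (If (Var 2) (Call p_push_char [:: Var 8; Var 1; Var 3]) (Var 8)) Q.
Proof.
have bge := budget_ge T.
move=> e8 e1 e2 e3 Hp okps lesz posE HQ; ev_run; rewrite e2 nat_of_bool_neq0.
case: ins {e2} lesz HQ => lesz HQ; ev_run; rewrite e8; last by apply: HQ => //; lia.
rewrite e1 e3; apply: (push_char_spec Hp okps lesz posE) => h1 v1 k1 x1 H1 hk1.
by apply: HQ => //; lia.
Qed.

(** Read as numbers, [ins] and [~~ ins] count inserted and deleted characters, so one statement
    covers both edits. In units of [budget], the longest run costs 2 + 15 for locating and deleting
    the split piece, 34 + 35 + 34 for the fragments and 1 + 15 + 28 for the next piece; 170 leaves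
    room for overhead. *)
Lemma main_spec h root ps i (ins : bool) a (Q : heap -> nat -> nat -> Prop) :
  stored h root ps -> all ok ps -> sorted (unmergeable T) ps ->
  size (flatten ps) < n -> i + ~~ ins <= size (flatten ps) ->
  (forall h' v k ps', stored h' v ps' -> all ok ps' ->
    sorted (unmergeable T) ps' ->
    flatten ps' = take i (flatten ps) ++ (if ins then [:: a] else [::])
                  ++ drop (i + ~~ ins) (flatten ps) ->
    k <= 170 * budget T -> Q h' v k) ->
  ev [:: root; i; (ins : nat); a] h (proc 0) Q.
Proof.
have bge := budget_ge T.
move=> Hp okps sps lesz lei HQ.
change (proc 0) with main_body; rewrite /main_body.
ev_run; apply: (@stored_length_of _ h 0 ps) => // k0 hk0.
(* Past the last character only an insertion is possible, and with nothing to the right there is no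
   junction to repair. *)
ev_run; case: ltnP => hi; last first.
  have ins1 : ins by case: (ins) lei => //; lia.
  have eqi : i = size (flatten ps) by lia.
  rewrite ins1 in HQ.
  ev_run; rewrite -{1}[ps]revK -[rev (rev ps)]/(catrev (rev ps) [::]) in Hp.
  have gps : good T (rev ps) by rewrite goodE revK okps.
  have tps : text (rev ps) = flatten ps by rewrite /text revK.
  apply: (push_char_spec Hp) => [|||h1 v1 k1 x1 H1 hk1].
  - by rewrite -[catrev _ _]/(rev (rev ps)) revK.
  - by rewrite tps /=; lia.
  - by rewrite tps.
  have := good_spush gps (piece_ok_char a); rewrite goodE => /andP[ok1 so1].
  apply: HQ H1 ok1 so1 _ _; last by lia.
  rewrite -[flatten _]/(text _) text_spush tps eqi take_size /= addn0 drop_size //.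
have [s1 [X [s2 [o [eqps eqi lto]]]]] := locate_piece hi.
rewrite eqps in Hp okps sps lesz lei HQ hi => {eqps}.
have leszn := ltnW lesz.
have leo : o + ~~ ins <= size X by case: (ins); lia.
have insE : 1 - ins = ~~ ins by case: (ins).
move: (okps); rewrite all_cat /= => /and3P[ok1 okX ok2].
have szE : size (flatten (s1 ++ X :: s2)) =
    size (flatten s1) + (size X + size (flatten s2)).
  by rewrite flatten_cat -[flatten (X :: s2)]/(X ++ flatten s2) !size_cat.
have p2 : path (unmergeable T) X s2 by move: sps; rewrite sorted_cat_cons => /andP[].
have okc z s : good T z -> all ok s -> all ok (catrev z s).
  by rewrite all_piece_ok_catrev => /andP[-> _] ->.
have t0 : text (rev s1) = flatten s1 by rewrite /text revK.
have g0 : good T (rev s1).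
  rewrite goodE revK ok1 /=; move: sps; rewrite -cat_rcons => /cat_sorted2[+ _].
  by rewrite -cats1 => /cat_sorted2[].
(* [z1], [z2] and [z3] are the zippers after the left remainder, the inserted character if any, and
   the right remainder. *)
pose z1 := spush_nonempty T (rev s1) (take o X).
have g1 : good T z1.
  apply: good_spush_nonempty => // A0.
  have o0 : 0 < o by case: (o) A0; rewrite ?take0.
  by have [] := @piece_ok_substring T X 0 o okX o0 (ltnW lto); rewrite drop0.
have t1 : text z1 = flatten s1 ++ take o X by rewrite text_spush_nonempty t0.
have sz1 : size (text z1) = i by rewrite t1 size_cat size_takel // ltnW.
pose z2 := if ins then spush T z1 [:: a] else z1.
have g2 : good T z2.
  by rewrite /z2; case: (ins) => //; apply: good_spush => //; apply: piece_ok_char.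
have t2 : text z2 = text z1 ++ (if ins then [:: a] else [::]).
  by rewrite /z2; case: (ins); rewrite ?cats0 ?text_spush.
have sz2 : size (text z2) = i + ins by rewrite t2 size_cat sz1; case: (ins).
pose m := size X - (o + ~~ ins).
have take_m : take m (drop (o + ~~ ins) X) = drop (o + ~~ ins) X.
  by rewrite take_oversize ?size_drop.
pose z3 := spush_nonempty T z2 (drop (o + ~~ ins) X).
have g3 : good T z3.
  apply: good_spush_nonempty => // B0.
  have m0 : 0 < m by rewrite /m -size_drop; case: drop B0.
  have [|+ _] := piece_ok_substring okX m0 (o := o + ~~ ins); first by rewrite subnKC.
  by rewrite take_m.
have t3 : text z3 = text z2 ++ drop (o + ~~ ins) X by rewrite text_spush_nonempty.
have sz3 : size (text z3) = i + ins + m by rewrite t3 size_cat sz2 size_drop.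
have goal_text : text z3 ++ flatten s2 =
    take i (flatten (s1 ++ X :: s2)) ++ (if ins then [:: a] else [::]) ++
    drop (i + ~~ ins) (flatten (s1 ++ X :: s2)).
  rewrite t3 t2 t1 flatten_cat -[flatten (X :: s2)]/(X ++ flatten s2).
  rewrite take_cat drop_cat eqi ltnNge leq_addr /= -addnA ltnNge leq_addr /= !addKn.
  rewrite take_cat lto drop_cat -!catA.
  case: ltnP => // ho; have -> : o + ~~ ins = size X by apply/eqP; rewrite eqn_leq leo ho.
  by rewrite drop_size subnn drop0.
have le1 : size (text (rev s1)) + o + size (flatten s2) <= n.
  by rewrite t0; clear -szE leszn lto; lia.
have le2 : size (text z1) + ins + size (flatten s2) <= n.
  by rewrite sz1; clear -szE lesz eqi lto; case: ins; lia.
(* After an insertion the text is one character longer than the pattern, so the strict bound [lesz]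
   is needed here. *)
have le3 : size (text z2) + m + size (flatten s2) <= n.
  by rewrite sz2 /m; clear -szE lesz eqi leo; case: ins leo; lia.
have le3' : size (text z3) + size (flatten s2) <= n by rewrite sz3 -sz2.
have pos1 : i - o = size (text (rev s1)) by rewrite t0 eqi addnK.
have leoX : 0 + o <= size X by exact: ltnW.
have leoX' : o + ~~ ins + m <= size X by rewrite subnKC.
have E0 : s1 ++ s2 = catrev (rev s1) s2 by rewrite catrevE revK.
ev_run; apply: (stored_find Hp okps leszn eqi lto) => nd k1 Hnd hk1.
ev_run; apply: (stored_offset Hp okps leszn eqi lto) => k2 hk2.
case: (Hnd) => _ [m2 _ _].
ev_run; rewrite m2 [(entry T X).1]/=.
apply: (stored_delete Hp okps leszn eqi lto) => h1 v1 k3 x1 H1 hk3.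
rewrite E0 in H1.
ev_run; apply: (push_sub_spec H1 (okc _ _ g0 ok2) okX (node_at_ext x1 Hnd) leoX le1 pos1).
rewrite drop0 -/z1 => h2 v2 k4 x2 H2 hk4.
ev_simpl; ev_step.
apply: (@maybe_push_char_spec _ h2 v2 i z1 s2 ins a) => //; first exact: okc.
rewrite -/z2 => h3 v3 k5 x3 H3 hk5.
ev_run; rewrite insE -/m.
apply: (push_sub_spec H3 (okc _ _ g2 ok2) okX _ leoX' le3) => //.
  (* The split piece is read again after its deletion from the tree; persistence keeps its node
     intact. *)
  exact: node_at_ext (hext_trans (hext_trans x1 x2) x3) Hnd.
rewrite take_m -/z3 => h4 v4 k6 x4 H4 hk6.
ev_run; apply: (@stored_length_of _ h4 8 (catrev z3 s2)) => // k7 hk7.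
ev_run; rewrite -sz3 flatten_catrev size_cat.
clear - HQ H4 g3 goal_text ok2 p2 okc le3' bge hk0 hk1 hk2 hk3 hk4 hk5 hk6 hk7 rmqP T0.
case: s2 HQ ok2 p2 H4 goal_text le3' => [|R s3] HQ ok2 p2 H4 goal_text le3'.
  rewrite [size (flatten [::])]/= addn0 ltnn; ev_run.
  move: g3; rewrite goodE => /andP[ok3 so3].
  apply: HQ H4 ok3 so3 _ _; last by lia.
  by rewrite -goal_text cats0.
case/andP: ok2 => okR ok3; case/andP: p2 => _ pR.
have szR : 0 < size R by case/andP: okR; case: (R).
have szRs : size (flatten (R :: s3)) = size R + size (flatten s3).
  by rewrite -[flatten _]/(R ++ flatten s3) size_cat.
have -> : size (text z3) < size (text z3) + size (flatten (R :: s3)).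
  by rewrite szRs -addn1 leq_add2l ltn_addr.
have okz : all ok (rev z3 ++ R :: s3) by rewrite -catrevE; apply: okc => //=; rewrite okR.
have eqpos : size (text z3) = size (flatten (rev z3)) + 0 by rewrite addn0.
have sz3' : size (text z3) + size R + size (flatten s3) <= n by rewrite -addnA -szRs.
have lez : size (flatten (rev z3 ++ R :: s3)) <= n by rewrite flatten_cat size_cat.
rewrite catrevE in H4.
ev_run; apply: (stored_find H4 okz lez eqpos szR) => v5 k8 [_ [r2 r3 r4]] hk8.
ev_run; rewrite r2 r3 r4.
apply: (stored_delete H4 okz lez eqpos szR) => h5 v6 k9 x5 H5 hk9.
rewrite -catrevE in H5.
ev_run; apply: (push_spec (X := R) H5 (okc _ _ g3 ok3) okR sz3')
  => // [|h6 v7 k10 x6 H6 hk10].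
  by rewrite /entry /=; case: SR.
apply: HQ H6 _ _ _ _.
- by apply: okc => //; apply: good_spush.
- exact: sorted_spush.
- by rewrite -goal_text flatten_catrev text_spush -catA.
- by clear - bge hk0 hk1 hk2 hk3 hk4 hk5 hk6 hk7 hk8 hk9 hk10; lia.
Qed.

End Update.

(* The program and the constant of the O(.) are uniform in everything but the
   alphabet exponent; the +1 in the bound only matters for |T| = 1. *)
Theorem theorem3 (c : nat) :
  exists (prog : program) (C : nat),
  forall (T P : str) (i : nat) (e : edit) (rmq : nat -> nat -> nat)
         (h : heap) (root : nat),
    over_alphabet c T T ->
    over_alphabet c T P ->
    over_alphabet c T (apply_edit P i e) ->
    is_rmq (LCP T) rmq ->
    size P < size T ->
    edit_ok P i e ->
    stores_partition h root P T ->
    exists (h' : heap) (root' time : nat),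
      [/\ runs T rmq prog (edit_args root i e) h h' root' time,
          time <= C * (trunc_log 2 (size T)).+1
        & stores_partition h' root' (apply_edit P i e) T].
Proof.
(* 170 units of [budget], each worth 1000 times the logarithmic factor. *)
exists update_program, (170 * 1000) => T P i e rmq h root _ _ _ rmqP ltPT iok.
case=> ps [t [/occurrence_partitionP[flP okps sps] it bt Ht]].
have T0 : 0 < size T by apply: leq_trans ltPT.
have Hps : stored T h root ps by exists t.
pose ins := if e is Insert _ then true else false.
pose a := if e is Insert b then b else 0.
have -> : edit_args root i e = [:: root; i; (ins : nat); a].
  by rewrite /ins /a; case: (e).
rewrite -{}flP in ltPT iok *.
have lei : i + ~~ ins <= size (flatten ps).
  by rewrite /ins; case: (e) iok => [b|] /=; rewrite ?addn0 ?addn1.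
pose Q h' v k := k <= 170 * budget T /\
  stores_partition h' v (apply_edit (flatten ps) i e) T.
have [|h' [v [k [run [lek Hv]]]]] :=
  main_spec rmqP T0 Hps okps sps ltPT lei (a := a) (Q := Q).
  move=> h' v k ps' [t' [Ht' it' bt']] ok' so' fl' lek; split=> //.
  exists ps', t'; split=> //; apply/occurrence_partitionP; split=> //.
  by rewrite fl' /ins /a; case: (e) => [b|] /=; rewrite ?addn0 ?addn1.
by exists h', v, k; split=> //; rewrite -mulnA.
Qed.
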